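(* $\mathsf{ACA}_0$ proves that every topological dynamical system $(C,f)$ on $2^\omega$ contains an almost periodic point.
   Context: Work in second order arithmetic; $\omega$ denotes the natural numbers of the model. $2^{<\omega}$ is the set of finite binary strings, $\lambda$ the empty string, $|\sigma|$ the length of $\sigma$, $\preceq$ the initial segment relation (also between a string and an infinite sequence), and $X\upharpoonright_n$ the initial segment of $X$ of length $n$. A tree is a subset of $2^{<\omega}$ closed under initial segments; $[C]$ denotes the collection of infinite paths through a tree $C$. A function $f:2^{<\omega}\to 2^{<\omega}$ encodes a continuous transformation of $2^\omega$ if (1) $f$ is total; (2) $f$ is order preserving, i.e. $\sigma\preceq\tau$ implies $f(\sigma)\preceq f(\tau)$; (3) $(\forall l)(\exists m)(\forall\sigma\in\{0,1\}^m)\,|f(\sigma)|\ge l$. By convention such an $f$ is also assumed to satisfy $|f(\sigma)|<|\sigma|$ for all $\sigma\ne\lambda$. The transformation encoded is $F(X)=\lim_l f(X\upharpoonright_l)$. Put $f^0(\sigma)=\sigma$, $f^k(\sigma)=f(f^{k-1}(\sigma))$ for $k>0$, and $F^k(X)=\lim_l f^k(X\upharpoonright_l)$. A pair $(C,f)$ is a (topological dynamical) system on $2^\omega$ if (i) $C$ is a tree; (ii) $f$ encodes a continuous transformation of $2^\omega$; (iii) $[C]\neq\emptyset$; (iv) for all $\sigma\in C$, $f(\sigma)\in C$. $X$ is an almost periodic point of $(C,f)$ if $X\in[C]$ and $(\forall c)(\exists b)(\forall n)(\exists k<b)\,(F^{n+k}(X)\succeq X\upharpoonright_c)$. *)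

(* Defs.v *)
From Stdlib Require Import List.
Import ListNotations.

Declare Scope L2_scope.
Delimit Scope L2_scope with L2.

(** * The two-sorted language of second order arithmetic

    Variables are de Bruijn indices, counted separately for the number sort
    and for the set sort.  As equality of sets is not a symbol of the language,
    the only set terms are set variables. *)

Inductive tm : Type :=
| Var (n : nat)
| Zero
| One
| Add (t u : tm)
| Mul (t u : tm).

Inductive fm : Type :=
| Eq (t u : tm)
| Lt (t u : tm)
| Mem (t : tm) (X : nat)
| Bot
| Imp (p q : fm)
| All (p : fm)
| AllS (p : fm).

(** The remaining connectives are the usual classical abbreviations. *)
Definition Not (p : fm) : fm := Imp p Bot.
Definition And (p q : fm) : fm := Not (Imp p (Not q)).
Definition Or (p q : fm) : fm := Imp (Not p) q.
Definition Iff (p q : fm) : fm := And (Imp p q) (Imp q p).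
Definition Ex (p : fm) : fm := Not (All (Not p)).
Definition ExS (p : fm) : fm := Not (AllS (Not p)).

Fixpoint tsubst (s : nat -> tm) (t : tm) : tm :=
  match t with
  | Var n => s n
  | Zero => Zero
  | One => One
  | Add t u => Add (tsubst s t) (tsubst s u)
  | Mul t u => Mul (tsubst s t) (tsubst s u)
  end.

Definition scons {A : Type} (a : A) (s : nat -> A) (n : nat) : A :=
  match n with O => a | S m => s m end.

Definition tshift : tm -> tm := tsubst (fun n => Var (S n)).
Definition up (s : nat -> tm) : nat -> tm := scons (Var 0) (fun n => tshift (s n)).
Definition upS (r : nat -> nat) : nat -> nat := scons 0 (fun n => S (r n)).

Fixpoint subst (s : nat -> tm) (r : nat -> nat) (p : fm) : fm :=
  match p with
  | Eq t u => Eq (tsubst s t) (tsubst s u)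
  | Lt t u => Lt (tsubst s t) (tsubst s u)
  | Mem t X => Mem (tsubst s t) (r X)
  | Bot => Bot
  | Imp p q => Imp (subst s r p) (subst s r q)
  | All p => All (subst (up s) r p)
  | AllS p => AllS (subst s (upS r) p)
  end.

Definition shift : fm -> fm := subst (fun n => Var (S n)) (fun X => X).
Definition shiftS : fm -> fm := subst Var S.
Definition inst (t : tm) : fm -> fm := subst (scons t Var) (fun X => X).
Definition instS (X : nat) : fm -> fm := subst Var (scons X (fun Y => Y)).

Fixpoint arithmetical (p : fm) : Prop :=
  match p with
  | Imp p q => arithmetical p /\ arithmetical q
  | All p => arithmetical p
  | AllS _ => False
  | _ => True
  end.

(** * Classical natural deduction

    The free variables of an axiom in [T] are read as universally quantified:
    [prv_ax] may be used below any number of generalizations, and only the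
    hypotheses in [A] are shifted by [prv_allI] and [prv_allSI]. *)

Inductive prv (T : fm -> Prop) : list fm -> fm -> Prop :=
| prv_ax A p : T p -> prv T A p
| prv_hyp A p : In p A -> prv T A p
| prv_impI A p q : prv T (p :: A) q -> prv T A (Imp p q)
| prv_impE A p q : prv T A (Imp p q) -> prv T A p -> prv T A q
| prv_raa A p : prv T (Not p :: A) Bot -> prv T A p
| prv_allI A p : prv T (map shift A) p -> prv T A (All p)
| prv_allE A p t : prv T A (All p) -> prv T A (inst t p)
| prv_allSI A p : prv T (map shiftS A) p -> prv T A (AllS p)
| prv_allSE A p X : prv T A (AllS p) -> prv T A (instS X p)
| prv_refl A t : prv T A (Eq t t)
| prv_eqE A p t u : prv T A (Eq t u) -> prv T A (inst t p) -> prv T A (inst u p).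

Definition proves (T : fm -> Prop) (p : fm) : Prop := prv T [] p.

(** * Writing formulas with Rocq binders

    A [form] is a formula placed under [d] number quantifiers and [e] set
    quantifiers.  The variable bound at depth [d] is passed to the body as the
    function giving its de Bruijn index at each depth [d' > d], so a formula
    written with the quantifiers below never shifts its arguments. *)

Definition nterm : Type := nat -> tm.
Definition sterm : Type := nat -> nat.
Definition form : Type := nat -> nat -> fm.

Definition sentence (p : form) : fm := p 0 0.

Definition fall (p : nterm -> form) : form :=
  fun d e => All (p (fun d' => Var (d' - S d)) (S d) e).
Definition fex (p : nterm -> form) : form :=
  fun d e => Ex (p (fun d' => Var (d' - S d)) (S d) e).
Definition fallS (p : sterm -> form) : form :=
  fun d e => AllS (p (fun e' => e' - S e) d (S e)).
Definition fexS (p : sterm -> form) : form :=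
  fun d e => ExS (p (fun e' => e' - S e) d (S e)).

Definition fzero : nterm := fun _ => Zero.
Definition fone : nterm := fun _ => One.
Definition fadd (t u : nterm) : nterm := fun d => Add (t d) (u d).
Definition fmul (t u : nterm) : nterm := fun d => Mul (t d) (u d).
Definition feq (t u : nterm) : form := fun d _ => Eq (t d) (u d).
Definition flt (t u : nterm) : form := fun d _ => Lt (t d) (u d).
Definition fmem (t : nterm) (X : sterm) : form := fun d e => Mem (t d) (X e).
Definition fnot (p : form) : form := fun d e => Not (p d e).
Definition fimp (p q : form) : form := fun d e => Imp (p d e) (q d e).
Definition fand (p q : form) : form := fun d e => And (p d e) (q d e).
Definition for_ (p q : form) : form := fun d e => Or (p d e) (q d e).
Definition fiff (p q : form) : form := fun d e => Iff (p d e) (q d e).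

Notation "∀ x .. y , p" := (fall (fun x => .. (fall (fun y => p)) ..))
  (at level 200, x binder, y binder, right associativity) : L2_scope.
Notation "∃ x .. y , p" := (fex (fun x => .. (fex (fun y => p)) ..))
  (at level 200, x binder, y binder, right associativity) : L2_scope.
Notation "∀² X .. Y , p" := (fallS (fun X => .. (fallS (fun Y => p)) ..))
  (at level 200, X binder, Y binder, right associativity) : L2_scope.
Notation "∃² X .. Y , p" := (fexS (fun X => .. (fexS (fun Y => p)) ..))
  (at level 200, X binder, Y binder, right associativity) : L2_scope.
Notation "0" := fzero : L2_scope.
Notation "1" := fone : L2_scope.
Notation "t + u" := (fadd t u) : L2_scope.
Notation "t * u" := (fmul t u) : L2_scope.
Notation "t = u" := (feq t u) : L2_scope.
Notation "t < u" := (flt t u) : L2_scope.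
Notation "t ∈ X" := (fmem t X) (at level 70) : L2_scope.
Notation "~ p" := (fnot p) : L2_scope.
Notation "p -> q" := (fimp p q) : L2_scope.
Notation "p /\ q" := (fand p q) : L2_scope.
Notation "p \/ q" := (for_ p q) : L2_scope.
Notation "p <-> q" := (fiff p q) : L2_scope.

Bind Scope L2_scope with nterm form.
Local Open Scope L2_scope.

(** * ACA_0 *)

(** [p] may have further free variables of both sorts as parameters; its number
    variable 0 is the element variable, and [shiftS] keeps the set being
    defined from occurring in [p]. *)
Definition comprehension (p : fm) : fm :=
  ExS (All (Iff (Mem (Var 0) 0) (shiftS p))).

Inductive ACA0 : fm -> Prop :=
| ax_succ_neq0 : ACA0 (sentence (∀ n, ~ (n + 1 = 0)))
| ax_succ_inj : ACA0 (sentence (∀ m n, m + 1 = n + 1 -> m = n))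
| ax_add0 : ACA0 (sentence (∀ m, m + 0 = m))
| ax_addS : ACA0 (sentence (∀ m n, m + (n + 1) = (m + n) + 1))
| ax_mul0 : ACA0 (sentence (∀ m, m * 0 = 0))
| ax_mulS : ACA0 (sentence (∀ m n, m * (n + 1) = m * n + m))
| ax_lt0 : ACA0 (sentence (∀ m, ~ (m < 0)))
| ax_ltS : ACA0 (sentence (∀ m n, m < n + 1 <-> m < n \/ m = n))
| ax_induction :
    ACA0 (sentence (∀² X, 0 ∈ X /\ (∀ n, n ∈ X -> n + 1 ∈ X) -> ∀ n, n ∈ X))
| ax_comprehension p : arithmetical p -> ACA0 (comprehension p).

(** * Finite sequences of numbers

    The pre-code (l, (a, b)) stands for the sequence of length [l] whose entry
    at [i < l] is the remainder of [a] modulo [b * (i + 1) + 1] (Gödel's beta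
    function).  The code of a sequence is its least pre-code, so that sequences
    are equal exactly when their codes are. *)

Definition fle (t u : nterm) : form := t < u \/ t = u.

Definition fpair (t u : nterm) : nterm := (t + u) * (t + u) + t.

Definition beta (a b i x : nterm) : form :=
  x < b * (i + 1) + 1 /\ ∃ q, a = q * (b * (i + 1) + 1) + x.

Definition len (s l : nterm) : form := ∃ a b, s = fpair l (fpair a b).

Definition entry (s i x : nterm) : form :=
  ∃ l a b, s = fpair l (fpair a b) /\ i < l /\ beta a b i x.

Definition same_seq (s t : nterm) : form :=
  (∀ l, len s l <-> len t l) /\ (∀ i x, entry s i x <-> entry t i x).

Definition seqcode (s : nterm) : form :=
  (∃ l, len s l) /\ ∀ t, t < s -> ~ same_seq s t.

(** * Finite and infinite binary sequences

    An element of Cantor space is given as a set of numbers, identified with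
    its characteristic function.  [prefix] and [prefix_inf] are meant for
    strings only. *)

Definition str (s : nterm) : form :=
  seqcode s /\ ∀ i x, entry s i x -> x = 0 \/ x = 1.

Definition prefix (s t : nterm) : form :=
  ∀ i x, entry s i x -> entry t i x.

Definition prefix_inf (s : nterm) (X : sterm) : form :=
  ∀ i x, entry s i x -> (x = 1 <-> i ∈ X).

(** [s] is the initial segment of [X] of length [l]. *)
Definition restr (X : sterm) (l s : nterm) : form :=
  str s /\ len s l /\ prefix_inf s X.

Definition tree (C : sterm) : form :=
  (∀ s, s ∈ C -> str s) /\
  (∀ s t, str s -> t ∈ C -> prefix s t -> s ∈ C).

Definition path (C X : sterm) : form :=
  ∀ l s, restr X l s -> s ∈ C.

(** * Codes of continuous transformations

    A function on strings is a set of pairs (argument, value). *)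

Definition maps (f : sterm) (s t : nterm) : form := fpair s t ∈ f.

Definition string_function (f : sterm) : form :=
  (∀ p, p ∈ f -> ∃ s t, str s /\ str t /\ p = fpair s t) /\
  (∀ s, str s -> ∃ t, maps f s t /\ ∀ u, maps f s u -> u = t).

Definition order_preserving (f : sterm) : form :=
  ∀ s t s' t', maps f s s' -> maps f t t' -> prefix s t -> prefix s' t'.

Definition unbounded (f : sterm) : form :=
  ∀ l, ∃ m, ∀ s, str s /\ len s m -> ∃ t k, maps f s t /\ len t k /\ fle l k.

Definition shortening (f : sterm) : form :=
  ∀ s t l k, maps f s t -> len s l -> len t k -> ~ (l = 0) -> k < l.

(** [shortening] is a normalization of codes, not needed for [f] to encode a
    continuous map; it makes [f^k(s)] empty once [k] reaches the length of [s]. *)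
Definition transformation (f : sterm) : form :=
  string_function f /\ order_preserving f /\ unbounded f /\ shortening f.

(** [t] is [f^k(s)], witnessed by the sequence [s, f(s), ..., f^k(s)]. *)
Definition iter (f : sterm) (k s t : nterm) : form :=
  ∃ w, seqcode w /\ len w (k + 1) /\ entry w 0 s /\ entry w k t /\
    ∀ i x y, i < k -> entry w i x -> entry w (i + 1) y -> maps f x y.

(** [Y] is [F^k(X)], the limit of [f^k] along the initial segments of [X]:
    each initial segment of [Y] is eventually extended. *)
Definition limit_iter (f : sterm) (k : nterm) (X Y : sterm) : form :=
  ∀ n r, restr Y n r ->
    ∃ m, ∀ l, fle m l ->
      ∃ s t, restr X l s /\ iter f k s t /\ prefix r t.

(** * Dynamical systems and almost periodic points *)

Definition system (C f : sterm) : form :=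
  tree C /\ transformation f /\ (∃² X, path C X) /\
  (∀ s t, s ∈ C -> maps f s t -> t ∈ C).

Definition almost_periodic (C f X : sterm) : form :=
  path C X /\
  ∀ c, ∃ b, ∀ n, ∃ k, k < b /\
    ∃² Y, limit_iter f (n + k) X Y /\ ∃ r, restr X c r /\ prefix_inf r Y.

(* Main.v *)
From Stdlib Require Import List Arith Lia Ring Cantor.
From Stdlib Require Import Classical FunctionalExtensionality PropExtensionality ClassicalEpsilon.
Require Import Defs.
Import ListNotations.

(** The calculus is complete: a formula that holds in every structure satisfying
    the axioms is derivable ([completeness], by a Henkin construction).  So it
    suffices to find an almost periodic point of a given system (C, f) inside an
    arbitrary structure satisfying ACA_0.  Its numbers may be nonstandard, hence
    all constructions rest on arithmetical comprehension and the induction that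
    it yields; finite sequences are handled through Gödel's beta function.

    The point is taken from a minimal subsystem.  Read a binary string w as the
    beginning of the characteristic function of a set of (codes of) strings, and
    let T_w be the tree of all t in C such that no iterate f^k(t) extends a
    string s with w(s) = 1.  Go through the strings s one after the other and
    decide to avoid s if the tree stays infinite.  The set A of avoided strings is
    arithmetical: it is the rightmost path through the pruned tree of all w for
    which T_w is infinite ([greedy_path], [avoided_set]).  A second use of
    [greedy_path] gives a point X of C lying on T_w for every initial segment w
    of A ([avoiding_point]).

    This X is almost periodic ([almost_periodic_point]).  Let s be its initial
    segment of length c.  Since X itself extends s, the string s is not avoided;
    so the attempt to avoid it failed, which means that for w = A|s followed by 1
    the tree T_w has no string of some length m.  Given n, the initial segment of
    F^n(X) of length m is in C but not in T_w, so one of its images under f^k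
    extends a string s' with w(s') = 1.  No F^(n+k)(X) extends a string in A,
    whence s' = s, and F^(n+k)(X) extends s.  As f shortens strings, k <= m unless
    s is empty, in which case k = 0 will do.  So m + 1 is the required bound. *)

(** * Substitution *)

Lemma tsubst_comp s s' t :
  tsubst s (tsubst s' t) = tsubst (fun n => tsubst s (s' n)) t.
Proof. induction t; cbn; congruence. Qed.

Lemma tsubst_Var t : tsubst Var t = t.
Proof. induction t; cbn; congruence. Qed.

Lemma up_comp s s' :
  (fun n => tsubst (up s) (up s' n)) = up (fun n => tsubst s (s' n)).
Proof.
  extensionality n; destruct n as [|n]; [reflexivity|].
  cbn; unfold tshift; now rewrite !tsubst_comp.
Qed.

Lemma subst_comp p : forall s s' r r',
  subst s r (subst s' r' p) = subst (fun n => tsubst s (s' n)) (fun X => r (r' X)) p.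
Proof.
  induction p as [t u|t u|t X| |p IHp q IHq|p IH|p IH]; intros s s' r r'; cbn;
    rewrite ?tsubst_comp; try reflexivity.
  - now rewrite IHp, IHq.
  - now rewrite IH, up_comp.
  - rewrite IH; do 2 f_equal. extensionality X; now destruct X.
Qed.

Lemma up_Var : up Var = Var.
Proof. extensionality n; now destruct n. Qed.

Lemma upS_id : upS (fun X => X) = fun X => X.
Proof. extensionality X; now destruct X. Qed.

Lemma subst_Var p : subst Var (fun X => X) p = p.
Proof.
  induction p as [t u|t u|t X| |p IHp q IHq|p IH|p IH]; cbn;
    rewrite ?tsubst_Var, ?up_Var, ?upS_id; congruence.
Qed.

Ltac subst_algebra :=
  unfold shift, shiftS, inst, instS; rewrite ?subst_comp; f_equal;
  let n := fresh in extensionality n; destruct n; cbn;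
  unfold tshift; rewrite ?tsubst_comp; cbn; rewrite ?tsubst_Var; reflexivity.

Lemma subst_shift s r p : subst (up s) r (shift p) = shift (subst s r p).
Proof. subst_algebra. Qed.

Lemma subst_shiftS s r p : subst s (upS r) (shiftS p) = shiftS (subst s r p).
Proof. subst_algebra. Qed.

Lemma subst_inst s r t p :
  subst s r (inst t p) = inst (tsubst s t) (subst (up s) r p).
Proof. subst_algebra. Qed.

Lemma subst_instS s r X p :
  subst s r (instS X p) = instS (r X) (subst s (upS r) p).
Proof. subst_algebra. Qed.

Lemma subst_scons s r t p : subst (scons t s) r p = inst t (subst (up s) r p).
Proof. subst_algebra. Qed.

Lemma subst_sconsS s r X p : subst s (scons X r) p = instS X (subst s (upS r) p).
Proof. subst_algebra. Qed.

Lemma tsubst_support t :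
  exists N, forall s s', (forall n, n < N -> s n = s' n) -> tsubst s t = tsubst s' t.
Proof.
  induction t as [n| | |t [N IHt] u [M IHu]|t [N IHt] u [M IHu]].
  - exists (S n); intros s s' H; apply H; lia.
  - now exists 0.
  - now exists 0.
  - exists (N + M); intros s s' H; cbn.
    rewrite (IHt s s'), (IHu s s'); trivial; intros; apply H; lia.
  - exists (N + M); intros s s' H; cbn.
    rewrite (IHt s s'), (IHu s s'); trivial; intros; apply H; lia.
Qed.

(** Freshness of the variables from [N] on, expressed by the effect of
    substitutions, since that is how it is used. *)
Definition supported (N : nat) (p : fm) : Prop :=
  forall s s' r r', (forall n, n < N -> s n = s' n /\ r n = r' n) ->
    subst s r p = subst s' r' p.

Lemma supported_mono N M p : supported N p -> N <= M -> supported M p.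
Proof. intros H HM s s' r r' E; apply H; intros n Hn; apply E; lia. Qed.

Lemma supported_ex p : exists N, supported N p.
Proof.
  induction p as [t u|t u|t X| |p [N IHp] q [M IHq]|p [N IH]|p [N IH]].
  1, 2: destruct (tsubst_support t) as [N Ht], (tsubst_support u) as [M Hu];
    exists (N + M); intros s s' r r' H; cbn;
    rewrite (Ht s s'), (Hu s s'); trivial; intros; apply H; lia.
  - destruct (tsubst_support t) as [N Ht]; exists (N + S X); intros s s' r r' H; cbn.
    rewrite (Ht s s'); [|intros; apply H; lia].
    f_equal; apply H; lia.
  - now exists 0.
  - exists (N + M); intros s s' r r' H; cbn.
    rewrite (IHp s s' r r'), (IHq s s' r r'); trivial; intros; apply H; lia.
  - exists N; intros s s' r r' H; cbn; f_equal; apply IH.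
    intros [|n] Hn; cbn; (split; [|apply H; lia]); trivial.
    f_equal; apply H; lia.
  - exists N; intros s s' r r' H; cbn; f_equal; apply IH.
    intros [|n] Hn; cbn; (split; [apply H; lia|]); trivial.
    f_equal; apply H; lia.
Qed.

Lemma supported_list A : exists N, forall p, In p A -> supported N p.
Proof.
  induction A as [|p A [N IH]]; [now exists 0|].
  destruct (supported_ex p) as [M Hp]; exists (N + M).
  intros q [<-|Hq]; eapply supported_mono; eauto; lia.
Qed.

(** * Weakening, substitution and generalization *)

(** An axiom is a scheme in its free variables, so derivations can be substituted
    into only if the set of axioms is closed under substitution. *)
Definition subst_closed (T : fm -> Prop) : Prop :=
  forall p s r, T p -> T (subst s r p).

Lemma prv_weaken T A p : prv T A p -> forall B, incl A B -> prv T B p.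
Proof.
  induction 1 as [A p H|A p H|A p q H IH|A p q H1 IH1 H2 IH2|A p H IH|A p H IH|A p t H IH
                 |A p H IH|A p X H IH|A t|A p t u H1 IH1 H2 IH2]; intros B HB.
  - now apply prv_ax.
  - apply prv_hyp; auto.
  - apply prv_impI, IH. intros x [<-|Hx]; [left|right]; auto.
  - eapply prv_impE; eauto.
  - apply prv_raa, IH. intros x [<-|Hx]; [left|right]; auto.
  - apply prv_allI, IH, incl_map, HB.
  - apply prv_allE; auto.
  - apply prv_allSI, IH, incl_map, HB.
  - apply prv_allSE; auto.
  - apply prv_refl.
  - eapply prv_eqE; eauto.
Qed.

Lemma prv_subst T (HT : subst_closed T) A p :
  prv T A p -> forall s r, prv T (map (subst s r) A) (subst s r p).
Proof.
  induction 1 as [A p H|A p H|A p q H IH|A p q H1 IH1 H2 IH2|A p H IH|A p H IH|A p t H IH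
                 |A p H IH|A p X H IH|A t|A p t u H1 IH1 H2 IH2]; intros s r; cbn in *.
  - apply prv_ax; auto.
  - apply prv_hyp, in_map, H.
  - apply prv_impI, IH.
  - eapply prv_impE; [apply IH1|apply IH2].
  - apply prv_raa, IH.
  - apply prv_allI. specialize (IH (up s) r). rewrite map_map in *.
    erewrite map_ext; [apply IH|]. intros q; symmetry; apply subst_shift.
  - rewrite subst_inst; apply prv_allE, IH.
  - apply prv_allSI. specialize (IH s (upS r)). rewrite map_map in *.
    erewrite map_ext; [apply IH|]. intros q; symmetry; apply subst_shiftS.
  - rewrite subst_instS; apply prv_allSE, IH.
  - apply prv_refl.
  - rewrite subst_inst in *. eapply prv_eqE; [apply IH1|].
    specialize (IH2 s r); now rewrite subst_inst in IH2.
Qed.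

(** A variable fresh for the hypotheses may be generalized: the renaming that
    sends it to 0 and shifts the other variables turns the hypotheses into
    their shifts. *)
Lemma prv_gen_fresh T (HT : subst_closed T) A p N :
  (forall q, In q (p :: A) -> supported N q) ->
  prv T A (inst (Var N) p) -> prv T A (All p).
Proof.
  intros HN H; apply prv_allI.
  set (s := fun n => if n =? N then Var 0 else Var (S n)).
  assert (Hs : forall n, n < N -> s n = Var (S n)).
  { intros n Hn; unfold s; destruct (Nat.eqb_spec n N); [lia|reflexivity]. }
  apply (prv_subst T HT) with (s := s) (r := fun X => X) in H.
  replace (subst s (fun X => X) (inst (Var N) p)) with p in H.
  2: { symmetry. unfold inst. rewrite subst_comp.
       transitivity (subst Var (fun X => X) p); [|apply subst_Var].
       apply HN; [now left|].
       intros [|n] Hn; cbn; (split; [|reflexivity]).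
       - unfold s; now rewrite Nat.eqb_refl.
       - apply Hs; lia. }
  erewrite map_ext_in; [apply H|].
  intros q Hq; apply HN; [now right|]. intros n Hn; now rewrite Hs.
Qed.

Lemma prv_genS_fresh T (HT : subst_closed T) A p N :
  (forall q, In q (p :: A) -> supported N q) ->
  prv T A (instS N p) -> prv T A (AllS p).
Proof.
  intros HN H; apply prv_allSI.
  set (r := fun X => if X =? N then 0 else S X).
  assert (Hr : forall X, X < N -> r X = S X).
  { intros n Hn; unfold r; destruct (Nat.eqb_spec n N); [lia|reflexivity]. }
  apply (prv_subst T HT) with (s := Var) (r := r) in H.
  replace (subst Var r (instS N p)) with p in H.
  2: { symmetry. unfold instS. rewrite subst_comp.
       transitivity (subst Var (fun X => X) p); [|apply subst_Var].
       apply HN; [now left|].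
       intros [|n] Hn; cbn; (split; [reflexivity|]).
       - unfold r; now rewrite Nat.eqb_refl.
       - apply Hr; lia. }
  erewrite map_ext_in; [apply H|].
  intros q Hq; apply HN; [now right|]. intros n Hn; now rewrite Hr.
Qed.

(** * Enumeration of formulas *)

Fixpoint tm_code (t : tm) : nat :=
  match t with
  | Var n => to_nat (0, n)
  | Zero => to_nat (1, 0)
  | One => to_nat (2, 0)
  | Add t u => to_nat (3, to_nat (tm_code t, tm_code u))
  | Mul t u => to_nat (4, to_nat (tm_code t, tm_code u))
  end.

Fixpoint fm_code (p : fm) : nat :=
  match p with
  | Eq t u => to_nat (0, to_nat (tm_code t, tm_code u))
  | Lt t u => to_nat (1, to_nat (tm_code t, tm_code u))
  | Mem t X => to_nat (2, to_nat (tm_code t, X))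
  | Bot => to_nat (3, 0)
  | Imp p q => to_nat (4, to_nat (fm_code p, fm_code q))
  | All p => to_nat (5, fm_code p)
  | AllS p => to_nat (6, fm_code p)
  end.

Ltac to_nat_inj :=
  repeat match goal with
  | H : to_nat _ = to_nat _ |- _ => apply to_nat_inj, pair_equal_spec in H; destruct H
  end.

Lemma tm_code_inj t : forall u, tm_code t = tm_code u -> t = u.
Proof.
  induction t; intros [] E; cbn [tm_code] in E; to_nat_inj; try discriminate;
    f_equal; auto.
Qed.

Lemma fm_code_inj p : forall q, fm_code p = fm_code q -> p = q.
Proof.
  induction p; intros [] E; cbn [fm_code] in E; to_nat_inj; try discriminate;
    f_equal; auto using tm_code_inj.
Qed.

Lemma fm_enumerable : exists enum : nat -> fm, forall p, exists n, enum n = p.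
Proof.
  exists (fun n => epsilon (inhabits Bot) (fun p => fm_code p = n)).
  intros p; exists (fm_code p); apply fm_code_inj.
  apply (epsilon_spec (inhabits Bot) (fun q => fm_code q = fm_code p)); eauto.
Qed.

(** * Semantics *)

Record structure : Type := {
  num : Type;
  set : Type;
  zero : num;
  one : num;
  add : num -> num -> num;
  mul : num -> num -> num;
  lt : num -> num -> Prop;
  mem : num -> set -> Prop }.

Fixpoint eval (M : structure) (v : nat -> num M) (t : tm) : num M :=
  match t with
  | Var n => v n
  | Zero => zero M
  | One => one M
  | Add t u => add M (eval M v t) (eval M v u)
  | Mul t u => mul M (eval M v t) (eval M v u)
  end.

Fixpoint sat (M : structure) (v : nat -> num M) (w : nat -> set M) (p : fm) : Prop :=
  match p with
  | Eq t u => eval M v t = eval M v u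
  | Lt t u => lt M (eval M v t) (eval M v u)
  | Mem t X => mem M (eval M v t) (w X)
  | Bot => False
  | Imp p q => sat M v w p -> sat M v w q
  | All p => forall x, sat M (scons x v) w p
  | AllS p => forall X, sat M v (scons X w) p
  end.

Definition model (T : fm -> Prop) (M : structure) : Prop :=
  forall p, T p -> forall v w, sat M v w p.

(** * Completeness *)

Section Completeness.

Context (T : fm -> Prop) (HT : subst_closed T).

Definition consistent (A : list fm) : Prop := ~ prv T A Bot.

Lemma prv_bot A p : prv T A Bot -> prv T A p.
Proof. intros H; apply prv_raa; apply (prv_weaken _ _ _ H); intros x; now right. Qed.

Lemma prv_contra A p : prv T A (Not p) -> prv T A p -> prv T A Bot.
Proof. apply prv_impE. Qed.

(** One step of the Henkin construction.  Only the finitely many hypotheses are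
    collected in lists, while the axioms are closed under substitution, so there
    always remain fresh variables to witness a refuted universal formula. *)
Lemma extension A q :
  consistent A -> exists B,
    incl A B /\ consistent B /\ (prv T B q \/ prv T B (Not q)) /\
    (forall p, q = Not (All p) -> prv T B q -> exists t, prv T B (Not (inst t p))) /\
    (forall p, q = Not (AllS p) -> prv T B q -> exists X, prv T B (Not (instS X p))).
Proof.
  intros HA; destruct (classic (consistent (q :: A))) as [Hq|Hq].
  2: { exists A; assert (Hnq : prv T A (Not q)) by (apply prv_impI, NNPP, Hq).
       repeat split; auto using incl_refl;
         intros p -> H'; destruct HA; exact (prv_contra _ _ Hnq H'). }
  assert (Hin : incl A (q :: A)) by (intros x; now right).
  assert (Hpq : forall B, prv T (B ++ q :: A) q)
    by (intros B; apply prv_hyp, in_or_app; right; now left).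
  destruct (classic (exists p, q = Not (All p))) as [[p ->]|Hall].
  { destruct (supported_list (p :: Not (All p) :: A)) as [N HN].
    exists (Not (inst (Var N) p) :: Not (All p) :: A); repeat split.
    - intros x Hx; now do 2 right.
    - intros H. apply Hq. apply (prv_contra _ (All p)); [apply prv_hyp; now left|].
      apply (prv_gen_fresh T HT) with N; [exact HN|]. now apply prv_raa.
    - left; apply (Hpq [_]).
    - intros p' E _; injection E as <-; exists (Var N); apply prv_hyp; now left.
    - discriminate. }
  destruct (classic (exists p, q = Not (AllS p))) as [[p ->]|HallS].
  { destruct (supported_list (p :: Not (AllS p) :: A)) as [N HN].
    exists (Not (instS N p) :: Not (AllS p) :: A); repeat split.
    - intros x Hx; now do 2 right.
    - intros H. apply Hq. apply (prv_contra _ (AllS p)); [apply prv_hyp; now left|].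
      apply (prv_genS_fresh T HT) with N; [exact HN|]. now apply prv_raa.
    - left; apply (Hpq [_]).
    - discriminate.
    - intros p' E _; injection E as <-; exists N; apply prv_hyp; now left. }
  exists (q :: A); repeat split; auto.
  - left; apply (Hpq []).
  - intros p ->; destruct Hall; eauto.
  - intros p ->; destruct HallS; eauto.
Qed.

Lemma henkin_extension A : consistent A ->
  exists O : fm -> Prop,
    (forall p, In p A -> O p) /\ ~ O Bot /\
    (forall B p, (forall q, In q B -> O q) -> prv T B p -> O p) /\
    (forall p, O p \/ O (Not p)) /\
    (forall p, O (Not (All p)) -> exists t, O (Not (inst t p))) /\
    (forall p, O (Not (AllS p)) -> exists X, O (Not (instS X p))).
Proof.
  intros HA; destruct fm_enumerable as [enum Henum].
  set (next := fun (B : {B | consistent B}) q =>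
    constructive_indefinite_description _ (extension (proj1_sig B) q (proj2_sig B))).
  set (step := fun B q => exist consistent (proj1_sig (next B q))
                 (proj1 (proj2 (proj2_sig (next B q))))).
  set (chain := fix chain n := match n with
    | O => exist consistent A HA | S n => step (chain n) (enum n) end).
  set (At := fun n => proj1_sig (chain n)).
  assert (Hstep : forall n, _) by (intros n; exact (proj2_sig (next (chain n) (enum n)))).
  change (fun n => proj1_sig (next (chain n) (enum n))) with (fun n => At (S n)) in Hstep.
  assert (Hmono : forall n m, n <= m -> incl (At n) (At m)).
  { intros n m Hnm; induction Hnm as [|m Hnm IH]; [apply incl_refl|].
    eapply incl_tran; [apply IH|]. apply Hstep. }
  assert (Hdec : forall n, prv T (At (S n)) (enum n) \/ prv T (At (S n)) (Not (enum n)))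
    by (intros n; apply Hstep).
  assert (Hcon : forall n, consistent (At n)) by (intros n; exact (proj2_sig (chain n))).
  assert (Hup : forall n m p, n <= m -> prv T (At n) p -> prv T (At m) p)
    by (intros n m p Hnm H; eapply prv_weaken; eauto).
  assert (Hwit : forall q, (exists n, prv T (At n) q) ->
            exists n, enum n = q /\ prv T (At (S n)) q).
  { intros q [m Hm]; destruct (Henum q) as [n <-]; exists n; split; trivial.
    destruct (Hdec n) as [H|H]; trivial.
    destruct (Hcon (m + S n)).
    apply prv_contra with (enum n); [apply (Hup (S n))|apply (Hup m)]; trivial; lia. }
  exists (fun p => exists n, prv T (At n) p); repeat split.
  - intros p Hp; exists 0; now apply prv_hyp.
  - intros [n Hn]; exact (Hcon n Hn).
  - intros B; induction B as [|q B IH]; intros p HB Hp.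
    + exists 0; apply (prv_weaken _ _ _ Hp); intros x [].
    + destruct (IH (Imp q p)) as [n Hn]; [intros; apply HB; now right|now apply prv_impI|].
      destruct (HB q) as [m Hm]; [now left|].
      exists (n + m); apply prv_impE with q; [apply (Hup n)|apply (Hup m)]; trivial; lia.
  - intros p; destruct (Henum p) as [n <-].
    destruct (Hdec n); [left|right]; eauto.
  - intros p Hp; destruct (Hwit _ Hp) as (n & E & Hn).
    destruct (Hstep n) as (_ & _ & _ & H & _). rewrite E in H.
    destruct (H p eq_refl) as [t Ht]; [now rewrite <- E in *|].
    exists t, (S n). unfold At; cbn; unfold step; cbn. now rewrite E.
  - intros p Hp; destruct (Hwit _ Hp) as (n & E & Hn).
    destruct (Hstep n) as (_ & _ & _ & _ & H). rewrite E in H.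
    destruct (H p eq_refl) as [t Ht]; [now rewrite <- E in *|].
    exists t, (S n). unfold At; cbn; unfold step; cbn. now rewrite E.
Qed.

(** In the term model the numbers are the terms up to provable equality.  The sets
    are just the set variables: equality of sets is not expressible, so they need
    no quotient. *)
Theorem completeness p :
  (forall M, model T M -> forall v w, sat M v w p) -> proves T p.
Proof.
  intros Hval; apply NNPP; intros Hp.
  destruct (henkin_extension [Not p]) as (O & HA & Hbot & Hded & Hmax & Hall & HallS).
  { intros H; apply Hp, prv_raa, H. }
  assert (Hax : forall q, T q -> O q).
  { intros q Hq; apply (Hded []); [intros ? []|]; now apply prv_ax. }
  assert (Himp : forall q r, O (Imp q r) <-> (O q -> O r)).
  { intros q r; split.
    - intros H Hq; apply (Hded [Imp q r; q]).
      + intros x [<-|[<-|[]]]; trivial.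
      + apply prv_impE with q; apply prv_hyp; cbn; auto.
    - intros H; destruct (Hmax q) as [Hq|Hq].
      + apply (Hded [r]); [intros x [<-|[]]; auto|].
        apply prv_impI, prv_hyp; cbn; auto.
      + apply (Hded [Not q]); [intros x [<-|[]]; auto|].
        apply prv_impI, prv_bot, prv_contra with q; apply prv_hyp; cbn; auto. }
  assert (Hnot : forall q, O (Not q) <-> ~ O q).
  { intros q; unfold Not; rewrite Himp; tauto. }
  assert (HAll : forall q, O (All q) <-> forall t, O (inst t q)).
  { intros q; split.
    - intros H t; apply (Hded [All q]); [intros x [<-|[]]; auto|].
      apply prv_allE, prv_hyp; cbn; auto.
    - intros H; apply NNPP; rewrite <- Hnot; intros Hn.
      destruct (Hall _ Hn) as [t Ht]; apply Hnot in Ht; auto. }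
  assert (HAllS : forall q, O (AllS q) <-> forall t, O (instS t q)).
  { intros q; split.
    - intros H t; apply (Hded [AllS q]); [intros x [<-|[]]; auto|].
      apply prv_allSE, prv_hyp; cbn; auto.
    - intros H; apply NNPP; rewrite <- Hnot; intros Hn.
      destruct (HallS _ Hn) as [t Ht]; apply Hnot in Ht; auto. }
  assert (Hrefl : forall t, O (Eq t t)).
  { intros t; apply (Hded []); [intros ? []|]; apply prv_refl. }
  assert (Heq : forall q t u, O (Eq t u) -> O (inst t q) -> O (inst u q)).
  { intros q t u H1 H2; apply (Hded [Eq t u; inst t q]).
    - intros x [<-|[<-|[]]]; trivial.
    - apply prv_eqE with t; apply prv_hyp; cbn; auto. }
  assert (Hsym : forall t u, O (Eq t u) -> O (Eq u t)).
  { intros t u H; specialize (Heq (Eq (Var 0) (tshift t)) _ _ H).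
    unfold inst in Heq; cbn in Heq; unfold tshift in Heq.
    rewrite !tsubst_comp in Heq; cbn in Heq; rewrite !tsubst_Var in Heq; auto. }
  assert (Hrw : forall t u (E : tm -> fm) q, (forall x, E x = inst x q) ->
            O (Eq t u) -> O (E t) <-> O (E u)).
  { intros t u E q HE H; rewrite !HE; split; apply Heq; auto. }
  set (cls := {c : tm -> Prop | exists t, c = fun u => O (Eq t u)}).
  set (mk := fun t => exist _ _ (ex_intro _ t eq_refl) : cls).
  assert (Hmk : forall t u, mk t = mk u <-> O (Eq t u)).
  { intros t u; split.
    - intros E; injection E as E. change ((fun u => O (Eq t u)) u). rewrite E; apply Hrefl.
    - intros H; apply eq_sig_hprop; [intros; apply proof_irrelevance|]; cbn.
      extensionality x; apply propositional_extensionality.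
      apply (Hrw t u (fun z => Eq z x) (Eq (Var 0) (tshift x))); trivial.
      intros z; unfold inst, tshift; cbn. now rewrite tsubst_comp; cbn; rewrite tsubst_Var. }
  set (rep := fun c : cls => proj1_sig (constructive_indefinite_description _ (proj2_sig c))).
  assert (Hrep : forall c, mk (rep c) = c).
  { intros [c Hc]; unfold rep; cbn.
    destruct (constructive_indefinite_description _ Hc) as [t ->]; cbn.
    apply eq_sig_hprop; [intros; apply proof_irrelevance|reflexivity]. }
  assert (Hrepmk : forall t, O (Eq (rep (mk t)) t)) by (intros t; apply Hmk, Hrep).
  set (M := {| num := cls; set := nat; zero := mk Zero; one := mk One;
               add := fun a b => mk (Add (rep a) (rep b));
               mul := fun a b => mk (Mul (rep a) (rep b));
               lt := fun a b => O (Lt (rep a) (rep b));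
               mem := fun a X => O (Mem (rep a) X) |}).
  assert (Hinst : forall x u, tsubst (scons x Var) (tshift u) = u).
  { intros x u; unfold tshift; rewrite tsubst_comp; cbn; apply tsubst_Var. }
  assert (Hcong : forall f, (f = Add \/ f = Mul) -> forall t t' u u',
            O (Eq t t') -> O (Eq u u') -> mk (f t u) = mk (f t' u')).
  { intros f Hf t t' u u' Ht Hu; transitivity (mk (f t' u)); apply Hmk.
    - apply (Hrw t t' (fun z => Eq (f t u) (f z u))
               (Eq (tshift (f t u)) (f (Var 0) (tshift u)))); trivial.
      intros z; unfold inst; cbn; rewrite Hinst; destruct Hf as [-> | ->]; cbn;
        now rewrite Hinst.
    - apply (Hrw u u' (fun z => Eq (f t' u) (f t' z))
               (Eq (tshift (f t' u)) (f (tshift t') (Var 0)))); trivial.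
      intros z; unfold inst; cbn; rewrite Hinst; destruct Hf as [-> | ->]; cbn;
        now rewrite Hinst. }
  assert (Heval : forall s t, eval M (fun n => mk (s n)) t = mk (tsubst s t)).
  { intros s; induction t as [n| | |t IHt u IHu|t IHt u IHu]; cbn; trivial;
      rewrite IHt, IHu; apply Hcong; auto. }
  assert (Htruth : forall q s r, sat M (fun n => mk (s n)) r q <-> O (subst s r q)).
  { assert (Hcons : forall t s, scons (mk t) (fun n => mk (s n)) = fun n => mk (scons t s n))
      by (intros t s; extensionality n; now destruct n).
    induction q as [t u|t u|t X| |q1 IH1 q2 IH2|q IH|q IH]; intros s r; cbn [sat subst].
    - rewrite !Heval; apply Hmk.
    - rewrite !Heval; cbn.
      transitivity (O (Lt (tsubst s t) (rep (mk (tsubst s u))))).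
      + apply (Hrw _ _ (fun z => Lt z _) (Lt (Var 0) (tshift (rep (mk (tsubst s u))))));
          trivial. intros z; unfold inst; cbn; now rewrite Hinst.
      + apply (Hrw _ _ (fun z => Lt _ z) (Lt (tshift (tsubst s t)) (Var 0))); trivial.
        intros z; unfold inst; cbn; now rewrite Hinst.
    - rewrite !Heval; cbn.
      apply (Hrw _ _ (fun z => Mem z _) (Mem (Var 0) (r X))); trivial.
    - split; [intros []|apply Hbot].
    - rewrite Himp, IH1, IH2; tauto.
    - rewrite HAll; split; intros H.
      + intros t; rewrite <- subst_scons, <- IH, <- Hcons; apply H.
      + intros c; rewrite <- (Hrep c), Hcons, IH, subst_scons; apply H.
    - rewrite HAllS; split; intros H X.
      + rewrite <- subst_sconsS, <- IH; apply H.
      + rewrite IH, subst_sconsS; apply H. }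
  assert (Hsurj : forall v : nat -> num M, v = fun n => mk (rep (v n)))
    by (intros v; extensionality n; now rewrite Hrep).
  assert (HM : model T M).
  { intros q Hq v w; rewrite (Hsurj v), Htruth; apply Hax, HT, Hq. }
  specialize (Hval M HM (fun n => mk (Var n)) (fun X => X)).
  apply Htruth in Hval; rewrite subst_Var in Hval.
  apply (proj1 (Hnot p)); trivial. apply HA; now left.
Qed.

End Completeness.

Lemma subst_arithmetical p : forall s r, arithmetical p -> arithmetical (subst s r p).
Proof.
  induction p; cbn; intros s r H; try tauto; auto. destruct H; auto.
Qed.

Lemma ACA0_subst_closed : subst_closed ACA0.
Proof.
  intros p s r [| | | | | | | | |q Hq].
  10: { replace (subst s r (comprehension q)) with (comprehension (subst (up s) r q)).
        - now apply ax_comprehension, subst_arithmetical.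
        - unfold comprehension, ExS, Iff, And, Not; cbn; now rewrite !subst_shiftS. }
  all: constructor.
Qed.

(** * The statement in a structure *)

Declare Scope model_scope.
Delimit Scope model_scope with M.

Notation "0" := (zero _) : model_scope.
Notation "1" := (one _) : model_scope.
Notation "x + y" := (add _ x y) : model_scope.
Notation "x * y" := (mul _ x y) : model_scope.
Notation "x < y" := (lt _ x y) : model_scope.
Notation "x ∈ X" := (mem _ x X) : model_scope.

Local Open Scope model_scope.

Section Predicates.

Context {M : structure}.

Implicit Types (s t u v a b c i k l m n p q r w x y : num M) (A C X Y f : set M).

(** The following predicates repeat the formulas that they interpret quantifier by
    quantifier and connective by connective: that is what allows [translate] to
    prove the equivalence by descending into both at once. *)

Definition le x y : Prop := x < y \/ x = y.

Definition pair x y : num M := (x + y) * (x + y) + x.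

Definition remainder a b i x : Prop :=
  x < b * (i + 1) + 1 /\ exists q, a = q * (b * (i + 1) + 1) + x.

Definition Len s l : Prop := exists a b, s = pair l (pair a b).

Definition Entry s i x : Prop :=
  exists l a b, s = pair l (pair a b) /\ i < l /\ remainder a b i x.

Definition Same s t : Prop :=
  (forall l, Len s l <-> Len t l) /\ (forall i x, Entry s i x <-> Entry t i x).

Definition Seq s : Prop := (exists l, Len s l) /\ forall t, t < s -> ~ Same s t.

Definition Str s : Prop := Seq s /\ forall i x, Entry s i x -> x = 0 \/ x = 1.

Definition Prefix s t : Prop := forall i x, Entry s i x -> Entry t i x.

Definition InitialPart s X : Prop := forall i x, Entry s i x -> (x = 1 <-> i ∈ X).

Definition Restr X l s : Prop := Str s /\ Len s l /\ InitialPart s X.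

Definition Tree C : Prop :=
  (forall s, s ∈ C -> Str s) /\
  (forall s t, Str s -> t ∈ C -> Prefix s t -> s ∈ C).

Definition Path C X : Prop := forall l s, Restr X l s -> s ∈ C.

Definition Maps f s t : Prop := pair s t ∈ f.

Definition StringFunction f : Prop :=
  (forall p, p ∈ f -> exists s t, Str s /\ Str t /\ p = pair s t) /\
  (forall s, Str s -> exists t, Maps f s t /\ forall u, Maps f s u -> u = t).

Definition OrderPreserving f : Prop :=
  forall s t s' t', Maps f s s' -> Maps f t t' -> Prefix s t -> Prefix s' t'.

Definition Unbounded f : Prop :=
  forall l, exists m, forall s, Str s /\ Len s m ->
    exists t k, Maps f s t /\ Len t k /\ le l k.

Definition Shortening f : Prop :=
  forall s t l k, Maps f s t -> Len s l -> Len t k -> ~ l = 0 -> k < l.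

Definition Transformation f : Prop :=
  StringFunction f /\ OrderPreserving f /\ Unbounded f /\ Shortening f.

Definition Iter f k s t : Prop :=
  exists w, Seq w /\ Len w (k + 1) /\ Entry w 0 s /\ Entry w k t /\
    forall i x y, i < k -> Entry w i x -> Entry w (i + 1) y -> Maps f x y.

Definition LimitIter f k X Y : Prop :=
  forall n r, Restr Y n r ->
    exists m, forall l, le m l ->
      exists s t, Restr X l s /\ Iter f k s t /\ Prefix r t.

Definition System C f : Prop :=
  Tree C /\ Transformation f /\ (exists X, Path C X) /\
  (forall s t, s ∈ C -> Maps f s t -> t ∈ C).

Definition AlmostPeriodic C f X : Prop :=
  Path C X /\
  forall c, exists b, forall n, exists k, k < b /\
    exists Y, LimitIter f (n + k) X Y /\ exists r, Restr X c r /\ InitialPart r Y.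

End Predicates.

Notation "x <= y" := (le x y) : model_scope.

Section Translation.

Local Open Scope nat_scope.

Context (M : structure).
Implicit Types (v : nat -> num M) (w : nat -> set M) (d e : nat) (p q : form).

Lemma sat_fall v w d e (p : nterm -> form) (P : num M -> Prop) :
  (forall x, sat M (scons x v) w (p (fun d' => Var (d' - S d)) (S d) e) <-> P x) ->
  sat M v w (fall p d e) <-> forall x, P x.
Proof. intros H; split; intros H' x; apply H, H'. Qed.

Lemma sat_fallS v w d e (p : sterm -> form) (P : set M -> Prop) :
  (forall X, sat M v (scons X w) (p (fun e' => e' - S e) d (S e)) <-> P X) ->
  sat M v w (fallS p d e) <-> forall X, P X.
Proof. intros H; split; intros H' x; apply H, H'. Qed.

Lemma sat_fex v w d e (p : nterm -> form) (P : num M -> Prop) :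
  (forall x, sat M (scons x v) w (p (fun d' => Var (d' - S d)) (S d) e) <-> P x) ->
  sat M v w (fex p d e) <-> exists x, P x.
Proof.
  intros H; cbn; split.
  - intros H'; apply NNPP; intros Hn; apply H'; intros x Hx; apply Hn; exists x; apply H, Hx.
  - intros [x Hx] H'; apply (H' x), H, Hx.
Qed.

Lemma sat_fexS v w d e (p : sterm -> form) (P : set M -> Prop) :
  (forall X, sat M v (scons X w) (p (fun e' => e' - S e) d (S e)) <-> P X) ->
  sat M v w (fexS p d e) <-> exists X, P X.
Proof.
  intros H; cbn; split.
  - intros H'; apply NNPP; intros Hn; apply H'; intros x Hx; apply Hn; exists x; apply H, Hx.
  - intros [x Hx] H'; apply (H' x), H, Hx.
Qed.

Lemma sat_fimp v w d e p q (P Q : Prop) :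
  (sat M v w (p d e) <-> P) -> (sat M v w (q d e) <-> Q) ->
  sat M v w (fimp p q d e) <-> (P -> Q).
Proof. cbn; tauto. Qed.

Lemma sat_fnot v w d e p (P : Prop) :
  (sat M v w (p d e) <-> P) -> sat M v w (fnot p d e) <-> ~ P.
Proof. cbn; tauto. Qed.

Lemma sat_fand v w d e p q (P Q : Prop) :
  (sat M v w (p d e) <-> P) -> (sat M v w (q d e) <-> Q) ->
  sat M v w (fand p q d e) <-> P /\ Q.
Proof. cbn; tauto. Qed.

Lemma sat_for v w d e p q (P Q : Prop) :
  (sat M v w (p d e) <-> P) -> (sat M v w (q d e) <-> Q) ->
  sat M v w (for_ p q d e) <-> P \/ Q.
Proof. cbn; tauto. Qed.

Lemma sat_fiff v w d e p q (P Q : Prop) :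
  (sat M v w (p d e) <-> P) -> (sat M v w (q d e) <-> Q) ->
  sat M v w (fiff p q d e) <-> (P <-> Q).
Proof. cbn; tauto. Qed.

End Translation.

Ltac translate :=
  cbv beta;
  lazymatch goal with
  | |- sat _ _ _ (fall _ _ _) <-> _ => apply sat_fall; intros ?; translate
  | |- sat _ _ _ (fallS _ _ _) <-> _ => apply sat_fallS; intros ?; translate
  | |- sat _ _ _ (fex _ _ _) <-> _ => apply sat_fex; intros ?; translate
  | |- sat _ _ _ (fexS _ _ _) <-> _ => apply sat_fexS; intros ?; translate
  | |- sat _ _ _ (fnot _ _ _) <-> _ => apply sat_fnot; translate
  | |- sat _ _ _ (fimp _ _ _ _) <-> _ => apply sat_fimp; translate
  | |- sat _ _ _ (fand _ _ _ _) <-> _ => apply sat_fand; translate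
  | |- sat _ _ _ (for_ _ _ _ _) <-> _ => apply sat_for; translate
  | |- sat _ _ _ (fiff _ _ _ _) <-> _ => apply sat_fiff; translate
  | _ => exact (iff_refl _)
  end.

Lemma sat_statement M v w :
  sat M v w (sentence (∀² C f, system C f -> ∃² X, almost_periodic C f X)%L2) <->
  forall C f : set M, System C f -> exists X, AlmostPeriodic C f X.
Proof.
  unfold sentence, system, almost_periodic, tree, transformation, path, string_function,
    order_preserving, unbounded, shortening, limit_iter, iter, restr, str, prefix,
    prefix_inf, seqcode, same_seq, entry, len, beta, maps, fle.
  unfold System, AlmostPeriodic, Tree, Transformation, Path, StringFunction,
    OrderPreserving, Unbounded, Shortening, LimitIter, Iter, Restr, Str, Prefix,
    InitialPart, Seq, Same, Entry, Len, remainder, Maps, le.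
  translate.
Qed.

(** * Arithmetical predicates *)

Lemma eval_tsubst M v s t : eval M v (tsubst s t) = eval M (fun n => eval M v (s n)) t.
Proof. induction t; cbn; congruence. Qed.

Lemma eval_up M v s x :
  (fun n => eval M (scons x v) (up s n)) = scons x (fun n => eval M v (s n)).
Proof.
  extensionality n; destruct n; cbn; trivial; unfold tshift; now rewrite eval_tsubst.
Qed.

Lemma upS_scons A (w : nat -> A) r X :
  (fun n => scons X w (upS r n)) = scons X (fun n => w (r n)).
Proof. extensionality n; now destruct n. Qed.

Lemma sat_subst M p : forall v w s r,
  sat M v w (subst s r p) <-> sat M (fun n => eval M v (s n)) (fun X => w (r X)) p.
Proof.
  induction p as [t u|t u|t X| |p IHp q IHq|p IH|p IH]; intros v w s r; cbn;
    rewrite ?eval_tsubst; try tauto.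
  - now rewrite IHp, IHq.
  - now setoid_rewrite IH; setoid_rewrite eval_up.
  - now setoid_rewrite IH; setoid_rewrite upS_scons.
Qed.

(** Without [some_set], a structure with no sets at all would satisfy every set of
    axioms, as there would be no assignments. *)
Class ACA0_model (M : structure) : Prop := {
  model_axioms : model ACA0 M;
  some_set : inhabited (set M) }.

Section Arithmetical.

Local Open Scope nat_scope.

Context {M : structure} {HM : ACA0_model M}.

Implicit Types (e : nat -> num M) (th : nat -> nat + num M).

Definition assign th e (i : nat) : num M :=
  match th i with inl k => e k | inr m => m end.

(** Terms and arithmetical formulas with parameters, as functions of an
    environment: [th] says which variables of the formula are read off the
    environment and which are parameters.  Keeping the functions in the foreground
    lets the tactic [ar] find the formula from the shape of a predicate. *)
Definition Tm (t : (nat -> num M) -> num M) : Prop :=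
  exists u th, forall e, t e = eval M (assign th e) u.

Definition Ar (P : (nat -> num M) -> Prop) : Prop :=
  exists p th w, arithmetical p /\ forall e, P e <-> sat M (assign th e) w p.

(** Two formulas with different parameters are brought together by giving the
    even variables to the first and the odd ones to the second. *)
Definition merge {A} (f g : nat -> A) (i : nat) : A :=
  if Nat.even i then f (Nat.div2 i) else g (Nat.div2 i).

Lemma merge_even A (f g : nat -> A) i : merge f g (2 * i) = f i.
Proof.
  unfold merge. rewrite Nat.even_mul, Nat.div2_double. reflexivity.
Qed.

Lemma merge_odd A (f g : nat -> A) i : merge f g (S (2 * i)) = g i.
Proof.
  unfold merge. rewrite Nat.even_succ, Nat.odd_mul, Nat.div2_succ_double. reflexivity.
Qed.

Lemma eval_merge_l th th' e u :
  eval M (assign (merge th th') e) (tsubst (fun i => Var (2 * i)) u) =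
  eval M (assign th e) u.
Proof.
  rewrite eval_tsubst; f_equal; extensionality i; cbn [eval]; unfold assign.
  now rewrite merge_even.
Qed.

Lemma eval_merge_r th th' e u :
  eval M (assign (merge th th') e) (tsubst (fun i => Var (S (2 * i))) u) =
  eval M (assign th' e) u.
Proof.
  rewrite eval_tsubst; f_equal; extensionality i; cbn [eval]; unfold assign.
  now rewrite merge_odd.
Qed.

Lemma Tm_var k : Tm (fun e => e k).
Proof. now exists (Var 0), (fun _ => inl k). Qed.

Lemma Tm_const m : Tm (fun _ => m).
Proof. now exists (Var 0), (fun _ => inr m). Qed.

Lemma Tm_add t t' : Tm t -> Tm t' -> Tm (fun e => add M (t e) (t' e)).
Proof.
  intros (u & th & H) (u' & th' & H'); eexists (Add _ _), (merge th th'); intros e; cbn.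
  rewrite H, H', <- (eval_merge_l th th'), <- (eval_merge_r th th' e u'); reflexivity.
Qed.

Lemma Tm_mul t t' : Tm t -> Tm t' -> Tm (fun e => mul M (t e) (t' e)).
Proof.
  intros (u & th & H) (u' & th' & H'); eexists (Mul _ _), (merge th th'); intros e; cbn.
  rewrite H, H', <- (eval_merge_l th th'), <- (eval_merge_r th th' e u'); reflexivity.
Qed.

Lemma Ar_ext P Q : (forall e, P e <-> Q e) -> Ar P -> Ar Q.
Proof.
  intros HPQ (p & th & w & Hp & H); exists p, th, w; split; trivial.
  intros e; now rewrite <- HPQ.
Qed.

Lemma Ar_const (P : Prop) : Ar (fun _ => P).
Proof.
  destruct (some_set) as [X].
  destruct (classic P) as [H|H];
    [exists (Imp Bot Bot)|exists Bot]; exists (fun _ => inl 0), (fun _ => X); cbn; tauto.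
Qed.

Lemma Ar_eq t t' : Tm t -> Tm t' -> Ar (fun e => t e = t' e).
Proof.
  intros (u & th & H) (u' & th' & H'); destruct some_set as [X].
  eexists (Eq _ _), (merge th th'), (fun _ => X); split; [exact I|]; intros e; cbn.
  rewrite H, H', <- (eval_merge_l th th'), <- (eval_merge_r th th' e u'); reflexivity.
Qed.

Lemma Ar_lt t t' : Tm t -> Tm t' -> Ar (fun e => lt M (t e) (t' e)).
Proof.
  intros (u & th & H) (u' & th' & H'); destruct some_set as [X].
  eexists (Lt _ _), (merge th th'), (fun _ => X); split; [exact I|]; intros e; cbn.
  rewrite H, H', <- (eval_merge_l th th'), <- (eval_merge_r th th' e u'); reflexivity.
Qed.

Lemma Ar_mem t X : Tm t -> Ar (fun e => mem M (t e) X).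
Proof.
  intros (u & th & H); exists (Mem u 0), th, (fun _ => X); split; [exact I|].
  intros e; cbn; now rewrite H.
Qed.

Lemma Ar_imp P Q : Ar P -> Ar Q -> Ar (fun e => P e -> Q e).
Proof.
  intros (p & th & w & Hp & H) (q & th' & w' & Hq & H').
  exists (Imp (subst (fun i => Var (2 * i)) (fun X => 2 * X) p)
              (subst (fun i => Var (S (2 * i))) (fun X => S (2 * X)) q)),
    (merge th th'), (merge w w').
  split; [split; apply subst_arithmetical; trivial|].
  intros e; cbn [sat]; rewrite !sat_subst, H, H'.
  erewrite (functional_extensionality (fun n => eval M _ (Var (2 * n))) (assign th e)),
    (functional_extensionality (fun n => eval M _ (Var (S (2 * n)))) (assign th' e)),
    (functional_extensionality (fun n => merge w w' (2 * n)) w),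
    (functional_extensionality (fun n => merge w w' (S (2 * n))) w'); [reflexivity|..];
    intros i; cbn [eval]; unfold assign; now rewrite ?merge_even, ?merge_odd.
Qed.

(** The environment variable 0 of the body becomes the bound variable. *)
Lemma Ar_all (P : (nat -> num M) -> num M -> Prop) :
  Ar (fun e => P (fun n => e (S n)) (e 0)) -> Ar (fun e => forall x, P e x).
Proof.
  intros (p & th & w & Hp & H).
  exists (All (subst (fun i => Var (match th i with inl 0 => 0 | _ => S i end))
                (fun X => X) p)),
    (fun i => match th i with inl (S k) => inl k | c => c end), w.
  split; [apply subst_arithmetical, Hp|].
  intros e; cbn [sat]; split; intros H' x; specialize (H' x).
  - apply sat_subst. apply (H (scons x e)) in H'.
    erewrite (functional_extensionality (fun n => eval M _ _)); [exact H'|].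
    intros i; cbn; unfold assign. destruct (th i) as [[|k]|m] eqn:E; cbn; trivial;
      now rewrite E.
  - apply (H (scons x e)). apply sat_subst in H'.
    erewrite (functional_extensionality (fun n => eval M _ _)) in H'; [exact H'|].
    intros i; cbn; unfold assign. destruct (th i) as [[|k]|m] eqn:E; cbn; trivial;
      now rewrite E.
Qed.

Lemma Ar_not P : Ar P -> Ar (fun e => ~ P e).
Proof. intros H; apply Ar_imp; [exact H|apply Ar_const]. Qed.

Lemma Ar_and P Q : Ar P -> Ar Q -> Ar (fun e => P e /\ Q e).
Proof.
  intros HP HQ; apply Ar_ext with (fun e => ~ (P e -> ~ Q e)); [intros e; tauto|].
  now apply Ar_not, Ar_imp; [|apply Ar_not].
Qed.

Lemma Ar_or P Q : Ar P -> Ar Q -> Ar (fun e => P e \/ Q e).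
Proof.
  intros HP HQ; apply Ar_ext with (fun e => ~ P e -> Q e); [intros e; tauto|].
  now apply Ar_imp; [apply Ar_not|].
Qed.

Lemma Ar_iff P Q : Ar P -> Ar Q -> Ar (fun e => P e <-> Q e).
Proof. intros HP HQ; apply Ar_and; now apply Ar_imp. Qed.

Lemma Ar_ex (P : (nat -> num M) -> num M -> Prop) :
  Ar (fun e => P (fun n => e (S n)) (e 0)) -> Ar (fun e => exists x, P e x).
Proof.
  intros HP; apply Ar_ext with (fun e => ~ forall x, ~ P e x).
  - intros e; split; [intros H; apply NNPP; firstorder|firstorder].
  - now apply Ar_not, (Ar_all (fun e x => ~ P e x)), Ar_not.
Qed.

Lemma comprehension_set (P : num M -> Prop) :
  Ar (fun e => P (e 0)) -> exists X, forall x, mem M x X <-> P x.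
Proof.
  intros (p & th & w & Hp & H).
  set (p' := subst (fun i => Var (match th i with inl _ => 0 | _ => S i end))
               (fun X => X) p).
  assert (Hax : ACA0 (comprehension p')) by (apply ax_comprehension, subst_arithmetical, Hp).
  apply NNPP; intros Hn.
  set (v := fun i => match th i with inr m => m | _ => zero M end).
  apply (model_axioms _ Hax v w); clear Hax; intros X HX; apply Hn; exists X.
  intros x; specialize (HX x).
  assert (Hx : P x <-> sat M (scons x v) (scons X w) (shiftS p')).
  { rewrite (H (fun _ => x)). unfold shiftS, p'. rewrite !sat_subst.
    erewrite (functional_extensionality (assign th _)); [reflexivity|].
    intros i; cbn; unfold assign, v; destruct (th i) eqn:E; cbn; trivial; now rewrite E. }
  rewrite Hx; cbn in HX; tauto.
Qed.

Lemma num_ind (P : num M -> Prop) :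
  Ar (fun e => P (e 0)) -> P (zero M) -> (forall n, P n -> P (add M n (one M))) ->
  forall n, P n.
Proof.
  intros HP H0 HS n; destruct (comprehension_set P HP) as [X HX].
  destruct some_set as [Y].
  assert (Hind := model_axioms _ ax_induction (fun _ => zero M) (fun _ => Y) X).
  cbn in Hind; apply HX, Hind; intros H; apply H; [apply HX, H0|].
  intros m Hm; apply HX, HS, HX, Hm.
Qed.

End Arithmetical.

Ltac ar :=
  cbv beta;
  lazymatch goal with
  | H : Ar ?P |- Ar ?P => exact H
  | |- Ar (fun _ => ?P) => apply Ar_const
  | |- Ar (fun e => @?P e -> @?Q e) => apply Ar_imp; ar
  | |- Ar (fun e => forall x, _) => apply Ar_all; ar
  | |- Ar (fun e => exists x, _) => apply Ar_ex; ar
  | |- Ar (fun e => ~ _) => apply Ar_not; ar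
  | |- Ar (fun e => _ /\ _) => apply Ar_and; ar
  | |- Ar (fun e => _ \/ _) => apply Ar_or; ar
  | |- Ar (fun e => _ <-> _) => apply Ar_iff; ar
  | |- Ar (fun e => _ = _) => apply Ar_eq; ar
  | |- Ar (fun e => lt _ _ _) => apply Ar_lt; ar
  | |- Ar (fun e => mem _ _ _) => apply Ar_mem; ar
  | |- Ar _ => progress unfold le, Restr, Iter, Str, Seq, Same, Prefix, InitialPart,
                 Maps, Entry, Len, remainder; ar
  | |- Tm (fun _ => ?c) => apply Tm_const
  | |- Tm (fun e => e _) => apply Tm_var
  | |- Tm (fun e => add _ _ _) => apply Tm_add; ar
  | |- Tm (fun e => mul _ _ _) => apply Tm_mul; ar
  | |- Tm (fun e => pair _ _) => unfold pair; ar
  end.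

Ltac induct :=
  match goal with |- forall n, @?P n => refine (num_ind P _ _ _); [ar| |] end; cbv beta.

(** * Arithmetic in a model *)

Section Model.

Context {M : structure} {HM : ACA0_model M}.

Implicit Types (a b c d i j k l m n p q r s t u v w x y z : num M) (A C G Q X Y f : set M).

Ltac axiom H := intros; destruct (some_set) as [X];
  let Hax := fresh in
  assert (Hax := model_axioms _ H (fun _ => 0) (fun _ => X)); cbn in Hax; auto.

Lemma succ_neq0 n : n + 1 <> 0.
Proof. axiom ax_succ_neq0; eauto. Qed.

Lemma succ_inj m n : m + 1 = n + 1 -> m = n.
Proof. axiom ax_succ_inj. Qed.

Lemma add_0_r m : m + 0 = m.
Proof. axiom ax_add0. Qed.

Lemma add_succ_r m n : m + (n + 1) = (m + n) + 1.
Proof. axiom ax_addS. Qed.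

Lemma mul_0_r m : m * 0 = 0.
Proof. axiom ax_mul0. Qed.

Lemma mul_succ_r m n : m * (n + 1) = m * n + m.
Proof. axiom ax_mulS. Qed.

Lemma nlt_0 m : ~ m < 0.
Proof. axiom ax_lt0; eauto. Qed.

Lemma lt_succ m n : m < n + 1 <-> m <= n.
Proof.
  axiom ax_ltS. specialize (H m n). unfold le. apply NNPP; tauto.
Qed.

Lemma add_0_l : forall n, 0 + n = n.
Proof.
  induct; [apply add_0_r|]. intros n IH; now rewrite add_succ_r, IH.
Qed.

Lemma add_succ_l m : forall n, (m + 1) + n = (m + n) + 1.
Proof.
  induct; [now rewrite !add_0_r|]. intros n IH; now rewrite !add_succ_r, IH.
Qed.

Lemma add_comm m : forall n, m + n = n + m.
Proof.
  induct; [now rewrite add_0_r, add_0_l|].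
  intros n IH; now rewrite add_succ_r, add_succ_l, IH.
Qed.

Lemma add_assoc m n : forall p, m + (n + p) = (m + n) + p.
Proof.
  induct; [now rewrite !add_0_r|]. intros p IH; now rewrite !add_succ_r, IH.
Qed.

Lemma mul_0_l : forall n, 0 * n = 0.
Proof.
  induct; [apply mul_0_r|]. intros n IH; now rewrite mul_succ_r, IH, add_0_r.
Qed.

Lemma mul_succ_l m : forall n, (m + 1) * n = m * n + n.
Proof.
  induct; [now rewrite !mul_0_r, add_0_r|].
  intros n IH; rewrite !mul_succ_r, IH, !add_succ_r; f_equal.
  now rewrite <- !add_assoc, (add_comm n m).
Qed.

Lemma mul_comm m : forall n, m * n = n * m.
Proof.
  induct; [now rewrite mul_0_r, mul_0_l|].
  intros n IH; now rewrite mul_succ_r, mul_succ_l, IH.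
Qed.

Lemma mul_1_l n : 1 * n = n.
Proof.
  rewrite <- (add_0_l 1), mul_succ_l, mul_0_l; apply add_0_l.
Qed.

Lemma mul_add_l m n : forall p, (m + n) * p = m * p + n * p.
Proof.
  induct; [now rewrite !mul_0_r, add_0_r|].
  intros p IH; rewrite !mul_succ_r, IH, <- !add_assoc; f_equal.
  now rewrite !add_assoc, (add_comm m).
Qed.

Lemma mul_assoc m n : forall p, m * (n * p) = (m * n) * p.
Proof.
  induct; [now rewrite !mul_0_r|].
  intros p IH. rewrite !mul_succ_r, <- IH.
  now rewrite mul_comm, mul_add_l, (mul_comm n m), (mul_comm (n * p)).
Qed.

Lemma num_semiring : semi_ring_theory 0 1 (add M) (mul M) (@eq (num M)).
Proof.
  constructor; intros.
  - apply add_0_l.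
  - apply add_comm.
  - apply add_assoc.
  - apply mul_1_l.
  - apply mul_0_l.
  - apply mul_comm.
  - apply mul_assoc.
  - apply mul_add_l.
Qed.

Add Ring num_ring : num_semiring.

Lemma add_cancel_r m n : forall k, m + k = n + k -> m = n.
Proof.
  induct; [now rewrite !add_0_r|].
  intros k IH H; apply IH, succ_inj; now rewrite <- !add_succ_r.
Qed.

Lemma add_cancel_l k m n : k + m = k + n -> m = n.
Proof. rewrite !(add_comm k); apply add_cancel_r. Qed.

Lemma zero_or_succ : forall n, n = 0 \/ exists m, n = m + 1.
Proof. induct; [now left|]. intros n _; right; now exists n. Qed.

Lemma add_succ_neq m n : m <> m + (n + 1).
Proof.
  intros H; apply (succ_neq0 n), (add_cancel_l m); rewrite <- H; ring.
Qed.

Lemma lt_add m n : m < m + (n + 1).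
Proof.
  revert n; induct.
  - rewrite add_0_l; apply lt_succ; now right.
  - intros n IH; rewrite (add_succ_r m (n + 1)); apply lt_succ; now left.
Qed.

Lemma lt_ex m n : m < n <-> exists d, n = m + (d + 1).
Proof.
  split.
  - revert n; induct; [intros H; now apply nlt_0 in H|].
    intros n IH H; apply lt_succ in H; destruct H as [H|<-].
    + destruct (IH H) as [d ->]; exists (d + 1); ring.
    + exists 0; ring.
  - intros [d ->]; apply lt_add.
Qed.

Lemma le_ex m n : m <= n <-> exists d, n = m + d.
Proof.
  unfold le; rewrite lt_ex; split.
  - intros [[d ->] | ->]; [now exists (d + 1)|exists 0; ring].
  - intros [d ->]; destruct (zero_or_succ d) as [-> | [k ->]]; [right; ring|left; eauto].
Qed.

Lemma le_add m n : m <= m + n.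
Proof. apply le_ex; eauto. Qed.

Lemma le_refl n : n <= n.
Proof. now right. Qed.

Lemma le_0 n : 0 <= n.
Proof. apply le_ex; exists n; ring. Qed.

Lemma le_trans m n p : m <= n -> n <= p -> m <= p.
Proof.
  rewrite !le_ex; intros [d ->] [d' ->]; exists (d + d'); ring.
Qed.

Lemma le_lt_trans m n p : m <= n -> n < p -> m < p.
Proof.
  rewrite le_ex, !lt_ex; intros [d ->] [d' ->]; exists (d + d'); ring.
Qed.

Lemma lt_le_trans m n p : m < n -> n <= p -> m < p.
Proof.
  rewrite le_ex, !lt_ex; intros [d ->] [d' ->]; exists (d + d'); ring.
Qed.

Lemma lt_irrefl n : ~ n < n.
Proof. rewrite lt_ex; intros [d H]; now apply add_succ_neq in H. Qed.

Lemma lt_not_le m n : m < n -> ~ n <= m.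
Proof. intros H1 H2; apply (lt_irrefl m), (lt_le_trans _ n); trivial. Qed.

Lemma lt_succ_diag n : n < n + 1.
Proof. apply lt_succ, le_refl. Qed.

Lemma lt_or_le m n : m < n \/ n <= m.
Proof.
  revert m; induct.
  - destruct (zero_or_succ n) as [-> | [k ->]]; [right; apply le_refl|].
    left; apply lt_ex; exists k; ring.
  - intros m [H|H]; [|right; apply le_trans with m; [exact H|apply le_add]].
    apply lt_ex in H; destruct H as [d ->].
    destruct (zero_or_succ d) as [-> | [k ->]].
    + right; right; ring.
    + left; apply lt_ex; exists k; ring.
Qed.

Lemma le_antisym m n : m <= n -> n <= m -> m = n.
Proof. intros [H|H]; trivial; intros H'; now apply lt_not_le in H. Qed.

Lemma succ_le m n : m < n <-> m + 1 <= n.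
Proof.
  rewrite lt_ex, le_ex; split; intros [d ->]; exists d; ring.
Qed.

Lemma common_upper m n : exists p, m <= p /\ n <= p.
Proof. exists (m + n); split; apply le_ex; [exists n|exists m]; ring. Qed.

Lemma least_number (P : num M -> Prop) :
  Ar (fun e => P (e O)) -> forall n, P n -> exists m, P m /\ forall k, k < m -> ~ P k.
Proof.
  intros HP n Hn; apply NNPP; intros Hno.
  destruct (comprehension_set P HP) as [X HX].
  assert (H : forall n, forall k, k < n -> ~ k ∈ X).
  { induct; [intros k Hk; now apply nlt_0 in Hk|].
    intros m IH k Hk Hkm; apply lt_succ in Hk; destruct Hk as [Hk | ->]; [now apply (IH k)|].
    apply Hno; exists m; split; [now apply HX|].
    intros k Hk Hk'; apply (IH k Hk), HX, Hk'. }
  apply (H (n + 1) n (lt_succ_diag n)), HX, Hn.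
Qed.

(** If x <= m < n, then m * m + x < (m + 1) * (m + 1) <= n * n. *)
Lemma square_lt m n x y :
  x <= m -> m < n -> m * m + x <> n * n + y.
Proof.
  rewrite le_ex, lt_ex; intros [z ->] [d ->] H.
  apply (add_succ_neq ((x + z) * (x + z) + x)
    (x + z + z + (x + z + x + z) * d + (d * d + d + d) + y)).
  etransitivity; [exact H|ring].
Qed.

Lemma pair_inj a b c d : pair a b = pair c d -> a = c /\ b = d.
Proof.
  unfold pair; intros H.
  assert (E : a + b = c + d).
  { destruct (lt_or_le (a + b) (c + d)) as [Hl|[Hl|Hl]]; auto; exfalso.
    - apply (square_lt _ _ a c (le_add a b)) in Hl; auto.
    - apply (square_lt _ _ c a (le_add c d)) in Hl; auto. }
  rewrite E in H; apply add_cancel_l in H; subst c.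
  split; trivial; now apply add_cancel_l in E.
Qed.

Lemma division m : forall a, exists q r, a = q * (m + 1) + r /\ r < m + 1.
Proof.
  induct.
  - exists 0, 0; split; [ring|apply lt_succ, le_0].
  - intros a (q & r & -> & H); apply lt_succ in H; destruct H as [H | ->].
    + exists q, (r + 1); split; [ring|].
      apply lt_succ; now apply succ_le.
    + exists (q + 1), 0; split; [ring|apply lt_succ, le_0].
Qed.

Lemma remainder_unique m q q' r r' :
  q * m + r = q' * m + r' -> r < m -> r' < m -> r = r'.
Proof.
  assert (H : forall q q' r r', q * m + r = q' * m + r' -> r < m -> q' <= q).
  { intros q1 q2 r1 r2 E H; destruct (lt_or_le q1 q2) as [Hq|]; trivial; exfalso.
    apply lt_ex in Hq; destruct Hq as [d ->].
    apply (lt_not_le _ _ H), le_ex; exists (d * m + r2).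
    apply (add_cancel_l (q1 * m)); rewrite E; ring. }
  intros E H1 H2; assert (q = q') as <- by (apply le_antisym; eauto).
  now apply add_cancel_l in E.
Qed.

(** * Congruences and the beta function *)

(** Multiples are added on both sides because there is no subtraction. *)
Definition cong m x y : Prop := exists p q, x + p * m = y + q * m.

Lemma cong_refl m x : cong m x x.
Proof. now exists 0, 0. Qed.

Lemma cong_trans m x y z : cong m x y -> cong m y z -> cong m x z.
Proof.
  intros (p & q & H) (p' & q' & H'); exists (p + p'), (q + q').
  transitivity (x + p * m + p' * m); [ring|]; rewrite H.
  transitivity (y + p' * m + q * m); [ring|]; rewrite H'; ring.
Qed.

Lemma cong_add m x y x' y' : cong m x y -> cong m x' y' -> cong m (x + x') (y + y').
Proof.
  intros (p & q & H) (p' & q' & H'); exists (p + p'), (q + q').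
  transitivity ((x + p * m) + (x' + p' * m)); [ring|]; rewrite H, H'; ring.
Qed.

Lemma cong_mul_r m x y z : cong m x y -> cong m (x * z) (y * z).
Proof.
  intros (p & q & H); exists (p * z), (q * z).
  transitivity ((x + p * m) * z); [ring|]; rewrite H; ring.
Qed.

Lemma cong_mul m x y x' y' : cong m x y -> cong m x' y' -> cong m (x * x') (y * y').
Proof.
  intros H H'; apply cong_trans with (y * x'); [now apply cong_mul_r|].
  rewrite !(mul_comm y); now apply cong_mul_r.
Qed.

Definition modulus b i : num M := b * (i + 1) + 1.

Lemma cong_remainder a b i x : x < modulus b i -> cong (modulus b i) a x -> remainder a b i x.
Proof.
  intros Hx (p & q & H); split; [exact Hx|].
  destruct (division (b * (i + 1)) a) as (q' & r & E & Hr); exists q'.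
  enough (r = x) as <- by exact E.
  apply (remainder_unique (modulus b i) (q' + p) q); trivial.
  rewrite (add_comm (q * _)), <- H, E; unfold modulus; ring.
Qed.

(** If the differences of the indices divide [b], then distinct moduli are
    coprime.  Modulo the larger modulus m_j, where j = i + d + 1 and
    b = (d + 1) e, we have m_i (j + 1) = d + 1 and B = b (j + 1) = -1, hence
    m_i (j + 1) e (j + 1) B = B^2 = 1. *)
Lemma modulus_inverse b i d e :
  b = (d + 1) * e ->
  exists v, cong (modulus b (i + (d + 1))) (modulus b i * v) 1.
Proof.
  intros Hb; set (j := i + (d + 1)).
  exists ((j + 1) * (e * (j + 1) * (b * (j + 1)))).
  rewrite mul_assoc.
  apply cong_trans with ((d + 1) * (e * (j + 1) * (b * (j + 1)))).
  - apply cong_mul_r; exists (d + 1), (j + 1); unfold modulus, j; ring.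
  - exists 1, (b * (j + 1)); unfold modulus; rewrite Hb; ring.
Qed.

Lemma common_multiple n : forall l, exists b,
  n <= b /\ forall d, d < l -> exists e, b = (d + 1) * e.
Proof.
  induct.
  - exists n; split; [apply le_refl|]. intros d Hd; now apply nlt_0 in Hd.
  - intros l (b & Hn & H); exists (b * (l + 1)); split.
    + apply le_trans with b; trivial; apply le_ex; exists (b * l); ring.
    + intros d Hd; apply lt_succ in Hd; destruct Hd as [Hd | ->].
      * destruct (H d Hd) as [e ->]; exists (e * (l + 1)); ring.
      * exists b; ring.
Qed.

Lemma collection G : forall l,
  (forall i, i < l -> exists x, pair i x ∈ G) ->
  exists n, forall i, i < l -> exists x, x <= n /\ pair i x ∈ G.
Proof.
  unfold le; induct.
  - exists 0; intros i Hi; now apply nlt_0 in Hi.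
  - intros l IH H; destruct IH as [n Hn].
    { intros i Hi; apply H, lt_succ; now left. }
    destruct (H l (lt_succ_diag l)) as [y Hy].
    destruct (common_upper n y) as (p & Hp & Hyp); exists p.
    intros i Hi; apply lt_succ in Hi; destruct Hi as [Hi | ->]; [|now exists y].
    destruct (Hn i Hi) as (x & Hx & Hix); exists x; split; trivial.
    now apply le_trans with n.
Qed.

(** Chinese remaindering, one modulus at a time: [p] is a common multiple of
    the moduli treated so far that is invertible modulo the later ones.  If u is
    its inverse modulo m_j, then adding p u (x + a (m_j - 1)) to [a] changes the
    residue modulo m_j to x + a m_j = x and leaves the earlier residues alone. *)
Lemma beta_lemma G l :
  (forall i, i < l -> exists x, pair i x ∈ G) ->
  exists a b, forall i, i < l -> exists x, pair i x ∈ G /\ remainder a b i x.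
Proof.
  intros HG; destruct (collection G l HG) as [n Hn].
  (* as [b] bounds all values to be coded, they are smaller than the moduli *)
  destruct (common_multiple n l) as (b & Hb & Hdiv).
  assert (H : forall j, j <= l -> exists a p,
    (forall i, i < j ->
      exists x, pair i x ∈ G /\ x <= b /\ cong (modulus b i) a x /\
      exists q, p = q * modulus b i) /\
    (forall i, j <= i -> i < l -> exists u, cong (modulus b i) (p * u) 1)).
  { unfold le, cong, modulus; induct.
    - intros _; exists 0, 1; split.
      + intros i Hi; now apply nlt_0 in Hi.
      + intros i _ _; exists 1, 0, 0; ring.
    - intros j IH Hj. change (j + 1 <= l) in Hj; apply succ_le in Hj.
      destruct IH as (a & p & Hlow & Hhigh); [now left|].
      destruct (Hn j Hj) as (x & Hx & HGx).
      destruct (Hhigh j (or_intror eq_refl) Hj) as [u Hu].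
      exists (a + p * (u * (x + a * (b * (j + 1))))), (p * modulus b j); split.
      + intros i Hi; apply lt_succ in Hi; destruct Hi as [Hi | ->].
        * destruct (Hlow i Hi) as (y & Hy & Hyb & Hc & q & Hq).
          exists y; repeat split; trivial.
          -- apply (cong_trans _ _ a); [|exact Hc].
             rewrite Hq; exists 0, (q * (u * (x + a * (b * (j + 1))))); unfold modulus; ring.
          -- exists (q * modulus b j); rewrite Hq; ring.
        * exists x; repeat split; trivial; [apply le_trans with n; trivial| |now exists p].
          apply (cong_trans _ _ (a + 1 * (x + a * (b * (j + 1))))).
          -- apply cong_add; [apply cong_refl|]. rewrite mul_assoc; now apply cong_mul_r.
          -- exists 0, a; ring.
      + intros i Hji Hil; change (j + 1 <= i) in Hji; apply succ_le in Hji.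
        destruct (Hhigh i (or_introl Hji) Hil) as [v Hv].
        apply lt_ex in Hji; destruct Hji as [d ->].
        destruct (Hdiv d) as [e He].
        { apply le_lt_trans with (j + (d + 1)); trivial; apply le_ex; exists (j + 1); ring. }
        destruct (modulus_inverse b j d e He) as [w Hw].
        exists (v * w); replace (p * modulus b j * (v * w)) with ((p * v) * (modulus b j * w))
          by ring.
        apply (cong_trans (modulus b (j + (d + 1))) _ (1 * 1)); [now apply cong_mul|].
        exists 0, 0; ring. }
  destruct (H l (le_refl l)) as (a & p & Hlow & _); exists a, b.
  intros i Hi; destruct (Hlow i Hi) as (x & Hx & Hxb & Hc & _); exists x; split; trivial.
  apply cong_remainder; trivial. unfold modulus; apply lt_succ.
  apply le_trans with b; trivial. apply le_ex; exists (b * i); ring.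
Qed.

(** * Finite sequences *)

Lemma Len_unique s l l' : Len s l -> Len s l' -> l = l'.
Proof.
  intros (a & b & ->) (a' & b' & H); apply pair_inj in H; tauto.
Qed.

Lemma Entry_precode l a b i x :
  Entry (pair l (pair a b)) i x <-> i < l /\ remainder a b i x.
Proof.
  split; [|intros []; now exists l, a, b].
  intros (l' & a' & b' & E & H).
  apply pair_inj in E; destruct E as [-> E].
  apply pair_inj in E; destruct E as [-> ->]; trivial.
Qed.

Lemma Entry_unique s i x y : Entry s i x -> Entry s i y -> x = y.
Proof.
  intros (l & a & b & -> & Hi & Hx & q & Hq) H; apply Entry_precode in H.
  destruct H as (_ & Hy & q' & Hq').
  apply (remainder_unique (b * (i + 1) + 1) q q'); trivial. congruence.
Qed.

Lemma Entry_lt s l i x : Entry s i x -> Len s l -> i < l.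
Proof.
  intros (l' & a & b & -> & Hi & _) (a' & b' & E).
  apply pair_inj in E; destruct E as [-> _]; trivial.
Qed.

Lemma Entry_ex s l i : Len s l -> i < l -> exists x, Entry s i x.
Proof.
  intros (a & b & ->) Hi. destruct (division (b * (i + 1)) a) as (q & x & E & Hx).
  exists x; apply Entry_precode; split; trivial; split; trivial; now exists q.
Qed.

Lemma Same_refl s : Same s s.
Proof. split; tauto. Qed.

Lemma Same_sym s t : Same s t -> Same t s.
Proof. intros [H H']; split; intros; symmetry; auto. Qed.

Lemma Same_trans s t u : Same s t -> Same t u -> Same s u.
Proof.
  intros [H1 H2] [H3 H4]; split; intros.
  - now rewrite H1.
  - now rewrite H2.
Qed.

Lemma Seq_ext s t l :
  Seq s -> Seq t -> Len s l -> Len t l -> (forall i x, Entry s i x -> Entry t i x) -> s = t.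
Proof.
  intros [_ Hs] [_ Ht] Hsl Htl H.
  assert (Hst : Same s t).
  { split.
    - intros l'; split; intros Hl'.
      + now rewrite (Len_unique _ _ _ Hl' Hsl).
      + now rewrite (Len_unique _ _ _ Hl' Htl).
    - intros i x; split; [apply H|]; intros Hx.
      destruct (Entry_ex s l i Hsl (Entry_lt _ _ _ _ Hx Htl)) as [y Hy].
      now rewrite (Entry_unique _ _ _ _ Hx (H _ _ Hy)). }
  destruct (lt_or_le s t) as [Hl|[Hl|Hl]]; auto; exfalso.
  - apply (Ht s Hl), Same_sym, Hst.
  - apply (Hs t Hl), Hst.
Qed.

(** Comprehension for finite sequences.  The beta function yields a pre-code, and
    the least number that stands for the same sequence is its code. *)
Lemma Seq_comprehension (P : num M -> num M -> Prop) l :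
  Ar (fun e => P (e 1%nat) (e 0%nat)) ->
  (forall i, i < l -> exists x, P i x) ->
  exists s, Seq s /\ Len s l /\ forall i x, Entry s i x -> P i x.
Proof.
  intros HP Htot.
  destruct (comprehension_set (fun z => exists i x, z = pair i x /\ P i x)) as [G HG].
  { ar. }
  destruct (beta_lemma G l) as (a & b & Hab).
  { intros i Hi; destruct (Htot i Hi) as [x Hx]; exists x; apply HG; eauto. }
  set (s0 := pair l (pair a b)).
  destruct (least_number (fun s => Same s s0)) with (n := s0) as (s & Hs & Hmin);
    [ar|apply Same_refl|].
  assert (Hl : Len s l) by (apply Hs; now exists a, b).
  exists s; split; [|split; trivial].
  - split; [now exists l|]. intros t Ht H; apply (Hmin t Ht), Same_trans with s; trivial.
    now apply Same_sym.
  - intros i x Hx. assert (Hi := Entry_lt _ _ _ _ Hx Hl).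
    destruct (Hab i Hi) as (y & Hy & Hr).
    assert (x = y) as ->.
    { apply (Entry_unique s i); trivial. apply Hs, Entry_precode; auto. }
    apply HG in Hy; destruct Hy as (i' & x' & E & Hy).
    apply pair_inj in E; destruct E as [-> ->]; trivial.
Qed.

Lemma Seq_snoc s l x : Seq s -> Len s l ->
  exists t, Seq t /\ Len t (l + 1) /\ Entry t l x /\
    forall i y, i < l -> Entry t i y <-> Entry s i y.
Proof.
  intros Hs Hl.
  destruct (Seq_comprehension (fun i y => Entry s i y \/ i = l /\ y = x) (l + 1))
    as (t & Ht & Htl & H).
  - ar.
  - intros i Hi; apply lt_succ in Hi; destruct Hi as [Hi | ->]; [|now exists x; right].
    destruct (Entry_ex s l i Hl Hi) as [y Hy]; exists y; now left.
  - exists t; do 2 (split; trivial).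
    assert (Ht' : forall i, i < l + 1 -> exists y, Entry t i y) by (intros; eapply Entry_ex; eauto).
    split.
    + destruct (Ht' l (lt_succ_diag l)) as [y Hy].
      destruct (H _ _ Hy) as [Hy'|[_ <-]]; trivial.
      now apply (Entry_lt _ _ _ _ Hy'), lt_irrefl in Hl.
    + assert (Hst : forall i y, i < l -> Entry t i y -> Entry s i y).
      { intros i y Hi Hy; destruct (H _ _ Hy) as [|[-> _]]; trivial. now apply lt_irrefl in Hi. }
      intros i y Hi; split; [now apply Hst|]. intros Hy.
      destruct (Ht' i) as [z Hz]; [apply lt_succ; now left|].
      now rewrite (Entry_unique _ _ _ _ Hy (Hst _ _ Hi Hz)).
Qed.

Lemma Seq_take s l m : Seq s -> Len s l -> m <= l ->
  exists t, Seq t /\ Len t m /\ Prefix t s.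
Proof.
  intros Hs Hl Hm.
  destruct (Seq_comprehension (fun i y => Entry s i y) m) as (t & Ht & Htl & H);
    [ar| |now exists t].
  intros i Hi; apply (Entry_ex s l); trivial; now apply lt_le_trans with m.
Qed.

(** * Strings *)

Lemma Str_Len s : Str s -> exists l, Len s l.
Proof. intros [[H _] _]; exact H. Qed.

Lemma Prefix_refl s : Prefix s s.
Proof. intros i x H; exact H. Qed.

Lemma Prefix_trans s t u : Prefix s t -> Prefix t u -> Prefix s u.
Proof. intros H H' i x Hx; apply H', H, Hx. Qed.

Lemma Prefix_le s t l m : Prefix s t -> Len s l -> Len t m -> l <= m.
Proof.
  intros H Hs Ht; destruct (lt_or_le m l) as [Hl|]; trivial; exfalso.
  destruct (Entry_ex s l m Hs Hl) as [x Hx].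
  apply (lt_irrefl m), (Entry_lt t m m x); auto.
Qed.

Lemma Prefix_eq s t l : Str s -> Str t -> Len s l -> Len t l -> Prefix s t -> s = t.
Proof. intros [Hs _] [Ht _] Hsl Htl H; now apply (Seq_ext s t l). Qed.

Lemma Prefix_agree s t i x y : Prefix s t -> Entry s i x -> Entry t i y -> x = y.
Proof. intros H Hx Hy; apply (Entry_unique t i); auto. Qed.

Lemma Prefix_comparable s t u l m :
  Prefix s u -> Prefix t u -> Len s l -> Len t m -> l <= m -> Prefix s t.
Proof.
  intros Hs Ht Hl Hm Hlm i x Hx.
  destruct (Entry_ex t m i Hm) as [y Hy].
  { apply lt_le_trans with l; trivial; now apply (Entry_lt s l i x). }
  now rewrite (Entry_unique u i x y (Hs _ _ Hx) (Ht _ _ Hy)).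
Qed.

Lemma Prefix_empty s t : Len s 0 -> Prefix s t.
Proof. intros H i x Hx; destruct (nlt_0 i); now apply (Entry_lt s 0 i x). Qed.

Lemma Str_empty : exists s, Str s /\ Len s 0.
Proof.
  destruct (Seq_comprehension (fun i x => False) 0) as (s & Hs & Hl & H); [ar| |].
  - intros i Hi; now apply nlt_0 in Hi.
  - exists s; repeat split; try apply Hs; trivial. intros i x Hx; now apply H in Hx.
Qed.

Lemma Str_take s l m : Str s -> Len s l -> m <= l ->
  exists t, Str t /\ Len t m /\ Prefix t s.
Proof.
  intros [Hs H] Hl Hm; destruct (Seq_take s l m Hs Hl Hm) as (t & Ht & Htm & Hts).
  exists t; repeat split; try apply Ht; trivial. intros i x Hx; apply (H i), Hts, Hx.
Qed.

Lemma Str_snoc s l x : Str s -> Len s l -> x = 0 \/ x = 1 ->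
  exists t, Str t /\ Len t (l + 1) /\ Prefix s t /\ Entry t l x.
Proof.
  intros [Hs H] Hl Hx; destruct (Seq_snoc s l x Hs Hl) as (t & Ht & Htl & Htx & Hst).
  exists t; split; [split; trivial|split; trivial; split; trivial].
  - intros i y Hy; assert (Hi := Entry_lt _ _ _ _ Hy Htl).
    apply lt_succ in Hi; destruct Hi as [Hi | ->].
    + apply (H i); now apply Hst.
    + now rewrite (Entry_unique _ _ _ _ Hy Htx).
  - intros i y Hy; apply Hst; trivial; now apply (Entry_lt s l i y).
Qed.

Lemma snoc_unique u s t l x :
  Len u l -> Str s -> Str t -> Len s (l + 1) -> Len t (l + 1) ->
  Prefix u s -> Prefix u t -> Entry s l x -> Entry t l x -> s = t.
Proof.
  intros Hu Hs Ht Hsl Htl Hus Hut Hx Hx'; apply (Prefix_eq s t (l + 1)); trivial.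
  intros i y Hy; assert (Hi := Entry_lt _ _ _ _ Hy Hsl).
  apply lt_succ in Hi; destruct Hi as [Hi | ->].
  - destruct (Entry_ex u l i Hu Hi) as [z Hz].
    rewrite (Entry_unique _ _ _ _ Hy (Hus _ _ Hz)); auto.
  - now rewrite (Entry_unique _ _ _ _ Hy Hx).
Qed.

Lemma last_bit s l : Str s -> Len s (l + 1) -> Entry s l 0 \/ Entry s l 1.
Proof.
  intros [_ H] Hl; destruct (Entry_ex s (l + 1) l Hl (lt_succ_diag l)) as [x Hx].
  destruct (H _ _ Hx) as [-> | ->]; auto.
Qed.

Lemma zero_neq_one : zero M <> 1.
Proof. intros H; apply (succ_neq0 0). rewrite add_0_l; auto. Qed.

Lemma Restr_ex X l : exists s, Restr X l s.
Proof.
  destruct (Seq_comprehension (fun i x => i ∈ X /\ x = 1 \/ ~ i ∈ X /\ x = 0) l)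
    as (s & Hs & Hl & H); [ar| |].
  - intros i _; destruct (classic (i ∈ X)); [exists 1|exists 0]; auto.
  - exists s; split; [split|split]; trivial.
    + intros i x Hx; apply H in Hx; tauto.
    + intros i x Hx; apply H in Hx; destruct Hx as [[Hi ->] | [Hi ->]]; [now split|].
      split; [|tauto]. intros E; now apply zero_neq_one in E.
Qed.

Lemma InitialPart_comparable X s t l m :
  Str s -> Str t -> Len s l -> Len t m -> InitialPart s X -> InitialPart t X ->
  l <= m -> Prefix s t.
Proof.
  intros [_ Hs] [_ Ht] Hsl Htm HsX HtX Hlm i x Hx.
  destruct (Entry_ex t m i Htm) as [y Hy].
  { apply lt_le_trans with l; trivial; now apply (Entry_lt s l i x). }
  assert (E : x = 1 <-> y = 1) by now rewrite (HsX _ _ Hx), (HtX _ _ Hy).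
  replace x with y; trivial.
  destruct (Hs _ _ Hx) as [-> | ->], (Ht _ _ Hy) as [-> | ->]; trivial;
    first [now apply E | symmetry; now apply E].
Qed.

Lemma Restr_prefix X l m s t : Restr X l s -> Restr X m t -> l <= m -> Prefix s t.
Proof.
  intros (Hs & Hsl & HsX) (Ht & Htm & HtX); now apply (InitialPart_comparable X).
Qed.

Lemma Restr_unique X l s t : Restr X l s -> Restr X l t -> s = t.
Proof.
  intros Hs Ht; apply (Prefix_eq s t l); try apply Hs; try apply Ht.
  now apply (Restr_prefix X l l); [..|apply le_refl].
Qed.

(** * Greedy paths *)

(** Each proper initial segment [u] is considered separately, so that initial
    segments of greedy strings are greedy; [u = w] exempts the end of [w], where
    no bit has been chosen yet. *)
Definition Greedy Q w : Prop :=
  Str w /\ forall u l, Str u -> Len u l -> Prefix u w ->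
    u ∈ Q /\
    forall v, Str v -> Len v (l + 1) -> Prefix u v -> Entry v l 1 -> v ∈ Q ->
      u = w \/ Prefix v w.

Lemma Greedy_prefix Q u w : Str u -> Prefix u w -> Greedy Q w -> Greedy Q u.
Proof.
  intros Hu Huw [Hw H]; split; trivial. intros t l Ht Htl Htu.
  destruct (H t l) as [HQ Hv]; trivial; [now apply Prefix_trans with u|].
  split; trivial. intros v Hv' Hvl Htv Hv1 HvQ.
  destruct (Str_Len u Hu) as [m Hm].
  assert (Hlm := Prefix_le t u l m Htu Htl Hm).
  destruct Hlm as [Hlm|<-]; [|left; now apply (Prefix_eq t u l)].
  apply succ_le in Hlm; right.
  destruct (Hv v) as [->|Hvw]; trivial.
  - (* here t is w, which is too short to have the initial segment u *)
    destruct (Str_Len w Hw) as [n Hn].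
    apply (Prefix_comparable v u w (l + 1) m); trivial.
    exfalso. apply (Len_unique _ _ _ Htl) in Hn; subst n.
    apply succ_le, (lt_not_le _ _) in Hlm; apply Hlm.
    now apply (Prefix_le u w m l).
  - now apply (Prefix_comparable v u w (l + 1) m).
Qed.

(** Where two greedy strings have a common beginning u, the next bit of both is 1
    if u followed by 1 is in [Q], and 0 otherwise. *)
Lemma Greedy_coherent Q : forall l, forall w w' l',
  Greedy Q w -> Greedy Q w' -> Len w l -> Len w' l' -> l <= l' -> Prefix w w'.
Proof.
  unfold Greedy; induct.
  - intros w w' l' _ _ Hw _ _; now apply Prefix_empty.
  - intros l IH w w' l' Hw Hw' Hl Hl' Hll'.
    destruct (Str_take w (l + 1) l) as (u & Hu & Hul & Huw); trivial;
      [apply Hw|apply le_add|].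
    destruct (Str_take w' l' (l + 1)) as (t & Ht & Htl & Htw'); trivial; [apply Hw'|].
    assert (Huw' : Prefix u w').
    { apply (IH u w' l'); trivial; [now apply (Greedy_prefix Q u w)|].
      apply le_trans with (l + 1); trivial; apply le_add. }
    assert (Hut : Prefix u t)
      by (apply (Prefix_comparable u t w' l (l + 1)); trivial; apply le_add).
    assert (Hneq : forall x m, Len x m -> l < m -> u <> x).
    { intros x m Hx Hm ->; rewrite (Len_unique _ _ _ Hul Hx) in Hm; now apply lt_irrefl in Hm. }
    enough (w = t) as -> by trivial.
    destruct Hw as [Hw HwG], Hw' as [Hw' Hw'G].
    destruct (classic (exists v, Str v /\ Len v (l + 1) /\ Prefix u v /\ Entry v l 1 /\ v ∈ Q))
      as [(v & Hv & Hvl & Huv & Hv1 & HvQ)|Hno].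
    + transitivity v; [symmetry|].
      * destruct (HwG u l) as [_ H]; trivial. destruct (H v) as [E|Hvw]; trivial.
        -- now apply (Hneq w (l + 1)) in E; [| |apply lt_succ_diag].
        -- now apply (Prefix_eq v w (l + 1)).
      * destruct (Hw'G u l) as [_ H]; trivial. destruct (H v) as [E|Hvw']; trivial.
        -- now apply (Hneq w' l') in E; [| |apply succ_le].
        -- apply (Prefix_eq v t (l + 1)); trivial.
           now apply (Prefix_comparable v t w' (l + 1) (l + 1)); [..|apply le_refl].
    + apply (snoc_unique u w t l 0); trivial.
      * destruct (last_bit w l Hw Hl) as [|H1]; trivial; destruct Hno.
        exists w; repeat split; trivial; try apply Hw.
        now apply (HwG w (l + 1)); [..|apply Prefix_refl].
      * destruct (last_bit t l Ht Htl) as [|H1]; trivial; destruct Hno.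
        exists t; repeat split; trivial; try apply Ht.
        now apply (Hw'G t (l + 1)).
Qed.

Lemma Greedy_ex Q :
  (forall s, Str s -> Len s 0 -> s ∈ Q) ->
  (forall s l, Str s -> Len s l -> s ∈ Q ->
    exists t, Str t /\ Len t (l + 1) /\ Prefix s t /\ t ∈ Q) ->
  forall l, exists w, Greedy Q w /\ Len w l.
Proof.
  intros H0 HS; unfold Greedy; induct.
  - destruct Str_empty as (w & Hw & Hl); exists w; split; trivial; split; trivial.
    intros u l Hu Hul Huw.
    assert (l = 0) as ->.
    { apply le_antisym; [|apply le_0]. now apply (Prefix_le u w). }
    split; [now apply H0|]. intros; left; now apply (Prefix_eq u w 0).
  - intros l (w & Hw & Hl).
    assert (H : exists t, Str t /\ Len t (l + 1) /\ Prefix w t /\ t ∈ Q /\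
      forall v, Str v -> Len v (l + 1) -> Prefix w v -> Entry v l 1 -> v ∈ Q -> v = t).
    { destruct Hw as [Hw HwG].
      destruct (classic (exists v, Str v /\ Len v (l + 1) /\ Prefix w v /\ Entry v l 1 /\ v ∈ Q))
        as [(v & Hv & Hvl & Hwv & Hv1 & HvQ)|Hno].
      - exists v; repeat (split; trivial). intros v' Hv' Hvl' Hwv' Hv1' _.
        now apply (snoc_unique w v' v l 1).
      - destruct (HS w l) as (t & Ht & Htl & Hwt & HtQ); trivial.
        + now apply (HwG w l); [..|apply Prefix_refl].
        + exists t; repeat (split; trivial). intros v Hv Hvl Hwv Hv1 HvQ.
          destruct Hno; now exists v. }
    destruct H as (t & Ht & Htl & Hwt & HtQ & Huniq).
    exists t; split; trivial; split; trivial. intros u m Hu Hum Hut.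
    destruct (Prefix_le u t m (l + 1) Hut Hum Htl) as [Hm | ->].
    2: { assert (u = t) as -> by now apply (Prefix_eq u t (l + 1)).
         split; [trivial|now left]. }
    apply lt_succ in Hm. destruct Hw as [Hw HwG].
    assert (Huw : Prefix u w) by now apply (Prefix_comparable u w t m l).
    destruct (HwG u m) as [HuQ H]; trivial; split; trivial.
    intros v Hv Hvm Huv Hv1 HvQ; right.
    destruct (H v) as [-> | Hvw]; trivial; [|now apply Prefix_trans with w].
    assert (m = l) as -> by now apply (Len_unique w).
    rewrite <- (Huniq v); trivial; apply Prefix_refl.
Qed.

(** The rightmost path of a pruned tree: each bit is 1 unless that leaves [Q].
    It is the union of the greedy strings, of which there is exactly one of each
    length. *)
Lemma greedy_path Q :
  (forall s, Str s -> Len s 0 -> s ∈ Q) ->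
  (forall s l, Str s -> Len s l -> s ∈ Q ->
    exists t, Str t /\ Len t (l + 1) /\ Prefix s t /\ t ∈ Q) ->
  exists X,
    (forall l s, Restr X l s -> s ∈ Q) /\
    (forall l s t, Restr X l s -> Str t -> Len t (l + 1) -> Prefix s t -> Entry t l 1 ->
      t ∈ Q -> l ∈ X).
Proof.
  intros H0 HS.
  destruct (comprehension_set (fun i => exists w, Greedy Q w /\ Entry w i 1)) as [X HX].
  { unfold Greedy; ar. }
  assert (Hpart : forall w, Greedy Q w -> InitialPart w X).
  { intros w Hw i x Hx; rewrite HX; split; [intros ->; now exists w|].
    intros (w' & Hw' & Hx').
    destruct (Str_Len w) as [l Hl]; [apply Hw|].
    destruct (Str_Len w') as [l' Hl']; [apply Hw'|].
    destruct (lt_or_le l l') as [Hll|Hll].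
    - apply (Prefix_agree w w' i); trivial. apply (Greedy_coherent Q l w w' l'); trivial. now left.
    - symmetry; apply (Prefix_agree w' w i); trivial.
      now apply (Greedy_coherent Q l' w' w l). }
  assert (Hrestr : forall l s, Restr X l s -> Greedy Q s).
  { intros l s Hs; destruct (Greedy_ex Q H0 HS l) as (w & Hw & Hl).
    replace s with w; trivial. apply (Restr_unique X l); trivial.
    split; [apply Hw|split; [trivial|now apply Hpart]]. }
  exists X; split.
  - intros l s Hs. destruct (Hrestr l s Hs) as [_ H].
    apply (H s l); [apply Hs..|apply Prefix_refl].
  - intros l s t Hs Ht Htl Hst Ht1 HtQ.
    destruct (Restr_ex X (l + 1)) as [w Hw]. destruct (Hrestr _ _ Hw) as [_ H].
    destruct (H s l) as [_ H']; [apply Hs..| |].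
    { apply (Restr_prefix X l (l + 1)); trivial; apply le_add. }
    destruct (H' t) as [-> |Htw]; trivial.
    + destruct Hs as (_ & Hl & _), Hw as (_ & Hl' & _).
      exfalso; apply (lt_irrefl l); rewrite (Len_unique w l (l + 1)) at 2; trivial.
      apply lt_succ_diag.
    + destruct Hw as (_ & _ & HwX). now apply (HwX l 1 (Htw _ _ Ht1)).
Qed.

(** * Iterates *)

Lemma Iter_0 f s t : Seq s -> (Iter f 0 s t <-> s = t).
Proof.
  intros Hs; split.
  - intros (w & _ & _ & H & H' & _); exact (Entry_unique _ _ _ _ H H').
  - intros <-.
    destruct (Seq_comprehension (fun i x => x = s) (0 + 1)) as (w & Hw & Hl & H);
      [ar|now exists s|].
    destruct (Entry_ex w (0 + 1) 0 Hl (lt_succ_diag 0)) as [x Hx].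
    assert (Hx' := H _ _ Hx); subst x.
    exists w; do 4 (split; trivial). intros i x y Hi; now apply nlt_0 in Hi.
Qed.

Lemma Iter_succ f k s t : Iter f (k + 1) s t <-> exists u, Iter f k s u /\ Maps f u t.
Proof.
  split.
  - intros (w & Hw & Hl & H0 & Hk & Hf).
    destruct (Seq_take w (k + 1 + 1) (k + 1) Hw Hl (le_add _ _)) as (w' & Hw' & Hl' & Hww').
    assert (Hat : forall i x, i < k + 1 -> Entry w i x -> Entry w' i x).
    { intros i x Hi Hx; destruct (Entry_ex w' (k + 1) i Hl' Hi) as [y Hy].
      now rewrite (Prefix_agree w w i x y (Prefix_refl w) Hx (Hww' _ _ Hy)). }
    destruct (Entry_ex w' (k + 1) k Hl' (lt_succ_diag k)) as [u Hu].
    exists u; split.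
    + exists w'; do 2 (split; trivial). split; [|split; trivial].
      * apply Hat; trivial; apply lt_succ, le_0.
      * intros i x y Hi Hx Hy; apply (Hf i); auto. apply lt_succ; now left.
    + apply (Hf k); auto using lt_succ_diag.
  - intros (u & (w & Hw & Hl & H0 & Hk & Hf) & Hut).
    destruct (Seq_snoc w (k + 1) t Hw Hl) as (w' & Hw' & Hl' & Hk' & Hww').
    exists w'; do 2 (split; trivial).
    split; [apply Hww'; trivial; apply lt_succ, le_0|split; trivial].
    intros i x y Hi Hx Hy. apply Hww' in Hx; trivial.
    apply lt_succ in Hi; destruct Hi as [Hi | ->].
    + apply Hww' in Hy; [now apply (Hf i)|]. apply lt_succ; now apply succ_le.
    + now rewrite (Entry_unique _ _ _ _ Hx Hk), (Entry_unique _ _ _ _ Hy Hk').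
Qed.

Section Iterates.

Context (f : set M) (Hf : Transformation f).

Lemma Maps_Str s t : Maps f s t -> Str s /\ Str t.
Proof.
  intros H; apply Hf in H; destruct H as (s' & t' & Hs & Ht & E).
  apply pair_inj in E; destruct E as [-> ->]; auto.
Qed.

Lemma Maps_ex s : Str s -> exists t, Maps f s t.
Proof. intros H; apply Hf in H; destruct H as (t & H & _); eauto. Qed.

Lemma Iter_Str s : Str s -> forall k t, Iter f k s t -> Str t.
Proof.
  intros Hs; induct.
  - intros t H; apply Iter_0 in H; [now subst t|apply Hs].
  - intros k _ t H; apply Iter_succ in H; destruct H as (u & _ & H).
    now apply Maps_Str in H.
Qed.

Lemma Iter_ex s : Str s -> forall k, exists t, Iter f k s t.
Proof.
  intros Hs; induct.
  - exists s; apply Iter_0; [apply Hs|trivial].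
  - intros k [u Hu]; destruct (Maps_ex u) as [t Ht]; [now apply (Iter_Str s Hs k)|].
    exists t; apply Iter_succ; eauto.
Qed.

Lemma Iter_mono s t : Str s -> Str t -> Prefix s t ->
  forall k s' t', Iter f k s s' -> Iter f k t t' -> Prefix s' t'.
Proof.
  intros Hs Ht Hst; induct.
  - intros s' t' H H'; apply Iter_0 in H, H'; [|apply Ht|apply Hs]; now subst.
  - intros k IH s' t' H H'; apply Iter_succ in H, H'.
    destruct H as (u & Hu & H), H' as (u' & Hu' & H').
    destruct Hf as (_ & Hord & _). apply (Hord u u'); auto.
Qed.

Lemma Iter_add s u n : Str s -> Iter f n s u ->
  forall k v, Iter f k u v -> Iter f (n + k) s v.
Proof.
  intros Hs Hn. assert (Hu := Iter_Str s Hs n u Hn). induct.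
  - intros v H; apply Iter_0 in H; [subst v|apply Hu]. now rewrite add_0_r.
  - intros k IH v H; apply Iter_succ in H; destruct H as (x & Hx & H).
    rewrite add_succ_r; apply Iter_succ; eauto.
Qed.

Lemma Iter_closed C : (forall s t, s ∈ C -> Maps f s t -> t ∈ C) ->
  forall s, Str s -> s ∈ C -> forall k t, Iter f k s t -> t ∈ C.
Proof.
  intros HC s Hs HsC; induct.
  - intros t H; apply Iter_0 in H; [now subst t|apply Hs].
  - intros k IH t H; apply Iter_succ in H; destruct H as (u & Hu & H); eauto.
Qed.

Lemma Maps_empty s t : Maps f s t -> Len s 0 -> Len t 0.
Proof.
  intros Hst Hs. destruct (Maps_Str _ _ Hst) as [HsS HtS].
  (* the value at the empty string is an initial segment of the value at a
     string of length 1, and that value is shorter than its argument *)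
  destruct (Str_snoc s 0 0 HsS Hs (or_introl eq_refl)) as (s' & Hs' & Hl' & _).
  destruct (Maps_ex s' Hs') as [t' Ht'].
  destruct (Str_Len t) as [l Hl]; trivial.
  destruct (Str_Len t') as [m Hm]; [now apply Maps_Str in Ht'|].
  destruct Hf as (_ & Hord & _ & Hshort).
  assert (Hmlt : m < 0 + 1) by (apply (Hshort s' t'); trivial; apply succ_neq0).
  assert (Hlm : l <= m).
  { apply (Prefix_le t t'); trivial. apply (Hord s s'); trivial; now apply Prefix_empty. }
  replace 0 with l; trivial. apply le_antisym; [|apply le_0].
  apply lt_succ, (le_lt_trans _ m); trivial.
Qed.

(** Each application of [f] costs a bit, so only the iterates f^k with k at most
    the length of a string can take it to a nonempty string. *)
Lemma Iter_shortening s l : Str s -> Len s l ->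
  forall k t m, Iter f k s t -> Len t m -> m = 0 \/ m + k <= l.
Proof.
  intros Hs Hl; induct.
  - intros t m H Hm; apply Iter_0 in H; [subst t|apply Hs].
    right; rewrite (Len_unique _ _ _ Hl Hm), add_0_r; apply le_refl.
  - intros k IH t m H Hm; apply Iter_succ in H; destruct H as (u & Hu & H).
    destruct (Str_Len u) as [n Hn]; [now apply Maps_Str in H|].
    destruct (IH u n Hu Hn) as [-> | Hle].
    + left; apply (Len_unique t); trivial; now apply (Maps_empty u).
    + destruct (classic (n = 0)) as [-> |Hn0].
      * left; apply (Len_unique t); trivial; now apply (Maps_empty u).
      * right. destruct Hf as (_ & _ & _ & Hshort).
        assert (Hmn := Hshort u t n m H Hn Hm Hn0).
        apply le_trans with (n + k); trivial.
        apply lt_ex in Hmn; destruct Hmn as [d ->]; apply le_ex; exists d; ring.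
Qed.

Lemma Iter_unbounded : forall k l, exists m, forall s, Str s -> Len s m ->
  exists t j, Iter f k s t /\ Len t j /\ l <= j.
Proof.
  induct.
  - intros l; exists l; intros s Hs Hl; exists s, l.
    split; [apply Iter_0; [apply Hs|trivial]|split; [trivial|apply le_refl]].
  - intros k IH l. destruct Hf as (_ & Hord & Hunb & _).
    destruct (Hunb l) as [m Hm], (IH m) as [n Hn]; exists n.
    intros s Hs Hsn; destruct (Hn s Hs Hsn) as (u & j & Hu & Hj & Hmj).
    assert (HuS := Iter_Str s Hs k u Hu).
    destruct (Str_take u j m HuS Hj Hmj) as (u' & Hu' & Hum & Hp).
    destruct (Hm u' (conj Hu' Hum)) as (t' & i & Ht' & Hi & Hli).
    destruct (Maps_ex u HuS) as [t Ht].
    destruct (Str_Len t) as [i' Hi']; [now apply Maps_Str in Ht|].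
    exists t, i'; split; [apply Iter_succ; eauto|split; trivial].
    apply le_trans with i; trivial. apply (Prefix_le t' t); trivial; now apply (Hord u' u).
Qed.

(** The limit consists of the positions where some iterate f^k(X|l) has a 1; these
    iterates extend each other, and their lengths are unbounded. *)
Lemma limit_ex k X : exists Y,
  (forall l s t, Restr X l s -> Iter f k s t -> InitialPart t Y) /\ LimitIter f k X Y.
Proof.
  destruct (comprehension_set (fun i => exists l s t,
    Restr X l s /\ Iter f k s t /\ Entry t i 1)) as [Y HY]; [ar|].
  assert (HX : forall l s t, Restr X l s -> Iter f k s t -> InitialPart t Y).
  { intros l s t Hs Ht i x Hx; rewrite HY; split; [intros ->; now exists l, s, t|].
    intros (l' & s' & t' & Hs' & Ht' & Hx').
    destruct (lt_or_le l l') as [Hll|Hll].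
    - apply (Prefix_agree t t' i); trivial.
      apply (Iter_mono s s') with k; trivial; [apply Hs|apply Hs'|].
      apply (Restr_prefix X l l'); trivial; now left.
    - symmetry; apply (Prefix_agree t' t i); trivial.
      apply (Iter_mono s' s) with k; trivial; [apply Hs'|apply Hs|].
      now apply (Restr_prefix X l' l). }
  exists Y; split; trivial. intros n r Hr.
  destruct (Iter_unbounded k n) as [m Hm]; exists m; intros l Hl.
  destruct (Restr_ex X l) as [s Hs], (Restr_ex X m) as [s0 Hs0].
  destruct (Hm s0) as (t0 & j & Ht0 & Hj & Hnj); [apply Hs0..|].
  destruct (Iter_ex s) with (k := k) as [t Ht]; [apply Hs|].
  exists s, t; do 2 (split; trivial). apply Prefix_trans with t0.
  - destruct Hr as (HrS & Hrn & HrY).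
    apply (InitialPart_comparable Y r t0 n j); trivial; [|now apply (HX m s0)].
    apply (Iter_Str s0) with k; trivial; apply Hs0.
  - apply (Iter_mono s0 s) with k; trivial; [apply Hs0|apply Hs|].
    now apply (Restr_prefix X m l).
Qed.

End Iterates.

(** * Almost periodic points *)

Section AlmostPeriodicPoints.

Context (C f : set M) (Hsys : System C f).

Let Htree : Tree C := proj1 Hsys.
Let Hf : Transformation f := proj1 (proj2 Hsys).

(** [w] is the beginning of the characteristic function of the set of strings to be
    avoided. *)
Definition Avoids t w : Prop :=
  forall k v s, Iter f k t v -> Str s -> Entry w s 1 -> ~ Prefix s v.

Lemma Avoids_prefix t t' w w' :
  Str t -> Str t' -> Prefix t' t -> Prefix w' w -> Avoids t w -> Avoids t' w'.
Proof.
  intros Ht Ht' Htt Hww H k v s Hv Hs Hws Hsv.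
  destruct (Iter_ex f Hf t Ht k) as [u Hu].
  apply (H k u s Hu Hs (Hww _ _ Hws)), Prefix_trans with v; trivial.
  now apply (Iter_mono f Hf t' t) with k.
Qed.

(** The greedy choice of the strings to be avoided.  Not avoiding the next string
    keeps the tree of [w] as it is, so the strings [w] with an infinite tree can
    always be extended, by 0. *)
Lemma avoided_set : exists A,
  (forall l w, Restr A l w -> forall m, exists t, t ∈ C /\ Len t m /\ Avoids t w) /\
  (forall l w v, Restr A l w -> ~ l ∈ A -> Str v -> Len v (l + 1) -> Prefix w v ->
    Entry v l 1 -> exists m, forall t, t ∈ C -> Len t m -> ~ Avoids t v).
Proof.
  destruct (comprehension_set (fun w => forall m, exists t, t ∈ C /\ Len t m /\ Avoids t w))
    as [Q HQ]; [unfold Avoids; ar|].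
  destruct (greedy_path Q) as (A & HA & HA').
  - intros w Hw Hl; apply HQ; intros m.
    destruct (proj1 (proj2 (proj2 Hsys))) as [X HX]. destruct (Restr_ex X m) as [t Ht].
    exists t; split; [now apply (HX m)|split; [apply Ht|]].
    intros k v s _ _ Hs; destruct (nlt_0 s). now apply (Entry_lt w 0 s 1).
  - intros w l Hw Hl HwQ.
    destruct (Str_snoc w l 0 Hw Hl (or_introl eq_refl)) as (v & Hv & Hvl & Hwv & Hv0).
    exists v; do 3 (split; trivial). apply HQ; intros m.
    destruct (proj1 (HQ w) HwQ m) as (t & HtC & Htm & Ht).
    exists t; do 2 (split; trivial). intros k u s Hu Hs Hvs. apply (Ht k u s Hu Hs).
    assert (Hsl := Entry_lt _ _ _ _ Hvs Hvl); apply lt_succ in Hsl.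
    destruct Hsl as [Hsl | ->].
    + destruct (Entry_ex w l s Hl Hsl) as [x Hx].
      now rewrite <- (Prefix_agree _ _ _ _ _ Hwv Hx Hvs).
    + now destruct zero_neq_one; apply (Entry_unique v l).
  - exists A; split.
    + intros l w Hw; apply HQ; now apply (HA l).
    + intros l w v Hw HlA Hv Hvl Hwv Hv1; apply NNPP; intros Hno; apply HlA.
      apply (HA' l w v); trivial. apply HQ; intros m; apply NNPP; intros Hm.
      apply Hno; exists m; intros t HtC Htm Ht; apply Hm; now exists t.
Qed.

(** The tree avoiding all of [A] is the intersection of the trees for the initial
    segments w of [A], and a path is found through the strings s that have, for
    each w and each length m, an extension of length m in the tree of w.  If
    neither s0 nor s1 had this property, then both would fail for a common w and
    a common m, as these trees shrink when w grows; but s has an extension for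
    this w and m. *)
Lemma avoiding_point A :
  (forall l w, Restr A l w -> forall m, exists t, t ∈ C /\ Len t m /\ Avoids t w) ->
  exists X, forall l s, Restr X l s -> s ∈ C /\ forall k w, Restr A k w -> Avoids s w.
Proof.
  intros HA.
  destruct (comprehension_set (fun s => forall j k w m, Len s j -> Restr A k w -> j <= m ->
    exists t, t ∈ C /\ Len t m /\ Prefix s t /\ Avoids t w)) as [Q HQ]; [unfold Avoids; ar|].
  assert (Hno : forall s l, Str s -> Len s l -> ~ s ∈ Q -> exists k0 m0, l <= m0 /\
    forall k w m t, k0 <= k -> m0 <= m -> Restr A k w -> t ∈ C -> Len t m ->
      Prefix s t -> ~ Avoids t w).
  { intros s l Hs Hl HsQ; apply NNPP; intros Hno; apply HsQ, HQ; clear HsQ.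
    intros j k0 w0 m0 Hj Hw0 Hjm. apply NNPP; intros Hext; apply Hno; exists k0, m0.
    rewrite (Len_unique _ _ _ Hl Hj); split; trivial.
    intros k w m t Hk Hm Hw HtC Htm Hst Ht; apply Hext.
    assert (HtS : Str t) by now apply Htree.
    destruct (Str_take t m m0 HtS Htm Hm) as (t0 & Ht0 & Htm0 & Hp); exists t0.
    split; [now apply Htree with t|split; trivial; split].
    - now apply (Prefix_comparable s t0 t j m0).
    - apply (Avoids_prefix t t0 w w0); trivial. now apply (Restr_prefix A k0 k). }
  destruct (greedy_path Q) as (X & HX & _).
  - intros s Hs Hl; apply HQ; intros j k w m _ Hw _.
    destruct (HA k w Hw m) as (t & HtC & Htm & Ht); exists t.
    repeat (split; trivial); now apply Prefix_empty.
  - intros s l Hs Hl HsQ; apply NNPP; intros Hn.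
    destruct (Str_snoc s l 0 Hs Hl (or_introl eq_refl)) as (s0 & Hs0 & Hl0 & Hss0 & H0).
    destruct (Str_snoc s l 1 Hs Hl (or_intror eq_refl)) as (s1 & Hs1 & Hl1 & Hss1 & H1).
    destruct (Hno s0 (l + 1)) as (k0 & m0 & Hm0 & Hno0); trivial.
    { intros HsQ0; apply Hn; now exists s0. }
    destruct (Hno s1 (l + 1)) as (k1 & m1 & _ & Hno1); trivial.
    { intros HsQ1; apply Hn; now exists s1. }
    destruct (common_upper k0 k1) as (k & Hk0 & Hk1), (common_upper m0 m1) as (m & Hm & Hm1).
    destruct (Restr_ex A k) as [w Hw].
    assert (Hlm : l + 1 <= m) by now apply le_trans with m0.
    destruct (proj1 (HQ s) HsQ l k w m Hl Hw) as (t & HtC & Htm & Hst & Ht).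
    { now left; apply succ_le. }
    assert (HtS : Str t) by now apply Htree.
    destruct (Str_take t m (l + 1) HtS Htm Hlm) as (u & Hu & Hul & Hut).
    assert (Hsu : Prefix s u)
      by (apply (Prefix_comparable s u t l (l + 1)); trivial; apply le_add).
    destruct (last_bit u l Hu Hul) as [Hu0|Hu1].
    + apply (Hno0 k w m t); trivial. now rewrite (snoc_unique s s0 u l 0).
    + apply (Hno1 k w m t); trivial. now rewrite (snoc_unique s s1 u l 1).
  - exists X; intros l s Hs.
    assert (H : forall k w, Restr A k w -> s ∈ C /\ Avoids s w).
    { intros k w Hw.
      destruct (proj1 (HQ s) (HX l s Hs) l k w l) as (t & HtC & Htl & Hst & Ht);
        [apply Hs|trivial|apply le_refl|].
      replace s with t; [now split|]. symmetry.
      apply (Prefix_eq s t l); trivial; [apply Hs|now apply Htree|apply Hs]. }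
    split; [|intros k w Hw; now apply (H k)].
    destruct (Restr_ex A 0) as [w Hw]; now apply (H 0 w).
Qed.

Theorem almost_periodic_point : exists X, AlmostPeriodic C f X.
Proof.
  destruct avoided_set as (A & HA & HA').
  destruct (avoiding_point A HA) as [X HX].
  exists X; split; [intros l s Hs; now apply (HX l)|].
  intros c. destruct (Restr_ex X c) as [s Hs]. assert (HsS : Str s) by apply Hs.
  assert (HsA : ~ s ∈ A).
  { intros HsA; destruct (Restr_ex A (s + 1)) as [w Hw].
    destruct (HX c s Hs) as [_ Hav].
    apply (Hav (s + 1) w Hw (zero M) s s); trivial; [| |apply Prefix_refl].
    - apply Iter_0; [apply HsS|trivial].
    - destruct Hw as (_ & Hl & HwA).
      destruct (Entry_ex w (s + 1) s Hl (lt_succ_diag s)) as [x Hx].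
      now replace 1 with x by now apply (HwA s x Hx). }
  destruct (Restr_ex A s) as [w Hw].
  destruct (Str_snoc w s 1) as (v & Hv & Hvl & Hwv & Hv1); [apply Hw..|now right|].
  destruct (HA' s w v) as [m Hm]; trivial.
  exists (m + 1); intros n.
  enough (H : exists k l t u, k < m + 1 /\ Restr X l t /\ Iter f (n + k) t u /\ Prefix s u).
  { destruct H as (k & l & t & u & Hk & Ht & Hu & Hsu); exists k; split; trivial.
    destruct (limit_ex f Hf (n + k) X) as (Y & HY & HlimY); exists Y; split; trivial.
    exists s; split; trivial. intros i x Hx; apply (HY l t u Ht Hu); auto. }
  destruct (Iter_unbounded f Hf n m) as [l Hl], (Restr_ex X l) as [t Ht].
  assert (HtS : Str t) by apply Ht.
  destruct (Hl t HtS) as (t' & j & Ht' & Hj & Hmj); [apply Ht|].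
  assert (Ht'S : Str t') by now apply (Iter_Str f Hf t HtS n).
  destruct (Str_take t' j m Ht'S Hj Hmj) as (z & Hz & Hzm & Hzt').
  assert (HzC : z ∈ C).
  { apply Htree with t'; trivial.
    apply (Iter_closed f C) with t n; trivial; [apply Hsys|now apply (HX l)]. }
  assert (Hz' : exists k u s', Iter f k z u /\ Str s' /\ Entry v s' 1 /\ Prefix s' u).
  { apply NNPP; intros Hno; apply (Hm z HzC Hzm). intros k u s' Hu Hs' Hvs' Hsu.
    apply Hno; now exists k, u, s'. }
  destruct Hz' as (k & u & s' & Hu & Hs' & Hvs' & Hsu).
  destruct (Iter_ex f Hf t' Ht'S k) as [u' Hu'].
  assert (Huu' : Prefix u u') by now apply (Iter_mono f Hf z t') with k.
  assert (Hit := Iter_add f Hf t t' n HtS Ht' k u' Hu').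
  assert (s' = s) as ->.
  { assert (Hlt := Entry_lt _ _ _ _ Hvs' Hvl). apply lt_succ in Hlt.
    destruct Hlt as [Hlt|]; trivial; exfalso.
    destruct (HX l t Ht) as [_ Hav].
    apply (Hav s w Hw (n + k) u' s'); trivial; [|now apply Prefix_trans with u].
    destruct (Entry_ex w s s') as [x Hx]; [apply Hw|trivial|].
    now rewrite <- (Prefix_agree _ _ _ _ _ Hwv Hx Hvs'). }
  destruct (Str_Len u) as [i Hi]; [now apply (Iter_Str f Hf z Hz k)|].
  destruct (Iter_shortening f Hf z m Hz Hzm k u i Hu Hi) as [-> | Hik].
  - exists 0, l, t, t'; rewrite add_0_r; split; [apply lt_succ, le_0|].
    do 2 (split; trivial). apply Prefix_empty.
    replace 0 with c; [apply Hs|]. apply le_antisym; [|apply le_0].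
    apply (Prefix_le s u); trivial; apply Hs.
  - exists k, l, t, u'; split; [|split; [trivial|split; [trivial|now apply Prefix_trans with u]]].
    apply lt_succ, le_trans with (i + k); trivial.
    apply le_ex; exists i; apply add_comm.
Qed.

End AlmostPeriodicPoints.

End Model.

Theorem proposition9 :
  proves ACA0
    (sentence (∀² C f, system C f -> ∃² X, almost_periodic C f X)%L2).
Proof.
  apply (completeness ACA0 ACA0_subst_closed); intros M HM v w.
  apply sat_statement; intros C f Hsys.
  assert (ACA0_model M) by (split; [exact HM|exact (inhabits (w O))]).
  now apply almost_periodic_point.
Qed.
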